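(* There exist absolute constants $c, c_0 > 0$ such that the following holds. Let $n \ge 1$, let $\epsilon, \delta \in (0, c_0)$, and let $A \in \mathbb{R}^{n\times n}$ be symmetric (not necessarily PSD) with $\max_{i,j}|A_{ij}| \le 1$. If Algorithm U below is run with expected sample size $s \ge \frac{c}{\epsilon^2 \delta}\log\frac{1}{\epsilon\delta}$, then with probability at least $1-\delta$ its output $\hat\lambda_1 \ge \dots \ge \hat\lambda_n$ is an additive $\epsilon n$-approximation to the spectrum of $A$.
   Context: Algorithm U (uniform sampling): input a symmetric $A \in \mathbb{R}^{n\times n}$ and a number $s>0$. If $s \ge n$, let $S = I_n$. Otherwise, include each index $i \in [n]$ independently with probability $p = s/n$; if $i_1<\dots<i_k$ are the included indices, let $S \in \mathbb{R}^{k\times n}$ be the matrix whose $r$-th row is $e_{i_r}^T/\sqrt{p}$. Output the $k$ eigenvalues of the $k\times k$ matrix $SAS^T$ together with $n-k$ additional zeros, sorted in non-increasing order. A sequence $\hat\lambda_1\ge\dots\ge\hat\lambda_n$ is an additive $\alpha$-approximation to the spectrum of a symmetric $A\in\mathbb{R}^{n\times n}$ with eigenvalues $\lambda_1(A)\ge\dots\ge\lambda_n(A)$ if $|\hat\lambda_i - \lambda_i(A)| \le \alpha$ for all $i\in[n]$. *)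

(* Defs.v *)
From mathcomp Require Import all_boot all_order all_algebra.
From mathcomp Require Import Rstruct.
From Stdlib Require Rpower R_sqrt ClassicalEpsilon.
Set Implicit Arguments. Unset Strict Implicit. Unset Printing Implicit Defensive.
Import Order.TTheory GRing.Theory Num.Theory.
Local Open Scope ring_scope.

Notation R := Rdefinitions.R.

Definition geR (x y : R) : bool := y <= x.

Definition is_spectrum (m : nat) (B : 'M[R]_m) (l : seq R) : Prop :=
  [/\ size l = m, sorted geR l & char_poly B = \prod_(x <- l) ('X - x%:P)].

Definition add_approx (lh l : seq R) (alpha : R) : Prop :=
  size lh = size l /\
  forall i : nat, (i < size l)%N -> `|nth 0 lh i - nth 0 l i| <= alpha.

Definition sampling_matrix (n : nat) (p : R) (T : {set 'I_n}) : 'M[R]_(#|T|, n) :=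
  \matrix_(r < #|T|, j < n) ((j == enum_val r)%:R / R_sqrt.sqrt p).

Definition sampled_matrix (n : nat) (A : 'M[R]_n) (p : R) (T : {set 'I_n})
  : 'M[R]_#|T| :=
  sampling_matrix p T *m A *m (sampling_matrix p T)^T.

Definition U_output (n k : nat) (mu : seq R) : seq R :=
  sort geR (mu ++ nseq (n - k) 0).

Definition U_succeeds_on (n : nat) (A : 'M[R]_n) (k : nat) (M : 'M[R]_k)
  (alpha : R) : Prop :=
  forall lam mu : seq R, is_spectrum A lam -> is_spectrum M mu ->
    add_approx (U_output n k mu) lam alpha.

Definition indicator (P : Prop) : R :=
  if ClassicalEpsilon.excluded_middle_informative P then 1 else 0.

(* Probability that Algorithm U, run with parameter s, succeeds with accuracy
   alpha.  If s >= n then S = I_n (deterministic); otherwise each index is kept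
   independently with probability p = s/n, so the random set T has probability
   p^|T| (1-p)^(n-|T|). *)
Definition U_success_prob (n : nat) (A : 'M[R]_n) (s alpha : R) : R :=
  if n%:R <= s then indicator (U_succeeds_on A A alpha)
  else let p := s / n%:R in
    \sum_(T : {set 'I_n})
       p ^+ #|T| * (1 - p) ^+ (n - #|T|) *
       indicator (U_succeeds_on A (sampled_matrix A p T) alpha).

(* Main.v *)
Require Import Defs.
From mathcomp Require Import all_boot all_order all_algebra.
From mathcomp Require Import Rstruct perm fingroup.
From mathcomp Require Import complex ring lra zify.
From Stdlib Require RIneq Exp_prop Rpower R_sqrt ClassicalEpsilon.
Set Implicit Arguments. Unset Strict Implicit. Unset Printing Implicit Defensive.
Import Order.TTheory GRing.Theory Num.Theory.
Local Open Scope ring_scope.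

(** Halving a sample is easier to analyse than taking a small sample at once.
    If each index is kept with probability theta >= 1/2, the rescaling matrix D
    (with D_ii = 1/theta on kept indices and 0 elsewhere) is at most 2, so
    eigenvalues of A below the target accuracy g cannot create errors larger
    than 2g.  For the remaining eigenvalues l_j, comparing the spectrum of
    D^(1/2) A D^(1/2) with a threshold t amounts to comparing the form
    D - t A^(-1) with I - t A^(-1) on suitable spans of eigenvectors, that is, to
    bounding D - I relative to the weights |1 - t/l_j|.  This is done by a
    matrix Khintchine inequality for trace moments of order about log n, and the
    choice of weights gives an expected squared error of order n log n.

    Sampling at rate p is a succession of such halvings.  The error of the step
    leading to an expected sample of size m is of order n sqrt(log m / m) after
    rescaling, so the errors form a geometric series dominated by the last step,
    and Chebyshev's inequality concludes, with no dependence on n. *)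

(** * The spectral theorem for real symmetric matrices *)

Section SpectralTheorem.
Variable R : rcfType.

Definition sqnorm n (x : 'rV[R]_n) : R := \sum_j x 0 j ^+ 2.

Lemma sqnormE n (x : 'rV[R]_n) : sqnorm x = (x *m x^T) 0 0.
Proof. by rewrite mxE; apply: eq_bigr => j _; rewrite mxE expr2. Qed.

Lemma sqnorm_ge0 n (x : 'rV[R]_n) : 0 <= sqnorm x.
Proof. by apply: sumr_ge0 => j _; apply: sqr_ge0. Qed.

Lemma sqnorm_eq0 n (x : 'rV[R]_n) : (sqnorm x == 0) = (x == 0).
Proof.
apply/eqP/eqP => [x0|->]; last by rewrite /sqnorm big1 // => j _; rewrite mxE expr0n.
apply/rowP => j; rewrite mxE; apply/eqP; rewrite -sqrf_eq0.
by apply/eqP; apply: (psumr_eq0P _ x0) => // k _; apply: sqr_ge0.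
Qed.

Lemma sqnorm_gt0 n (x : 'rV[R]_n) : (0 < sqnorm x) = (x != 0).
Proof. by rewrite lt_def sqnorm_eq0 sqnorm_ge0 andbT. Qed.

(** If a + ib is an eigenvector for the complex eigenvalue z, equating a A b^T with b A a^T gives Im
    z (|a|^2 + |b|^2) = 0. Hence z is real, and whichever of a and b is nonzero is a real
    eigenvector. *)
Lemma symmetric_eigenvector n (A : 'M[R]_n) : (0 < n)%N -> A^T = A ->
  exists (v : 'rV[R]_n) (a : R), v != 0 /\ v *m A = a *: v.
Proof.
move=> n_gt0 Asym.
have [z /eigenvalueP[w wz w0]] :=
  eigenvalue_closed (map_mx (real_complex R) A) n_gt0.
pose a : 'rV[R]_n := map_mx (@complex.Re R) w.
pose b : 'rV[R]_n := map_mx (@complex.Im R) w.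
have Ra : a *m A = complex.Re z *: a - complex.Im z *: b.
  apply/rowP => j; move/rowP/(_ j)/(congr1 (@complex.Re R)): wz.
  rewrite !mxE raddf_sum /= => wz; transitivity (complex.Re (z * w 0 j)).
    rewrite -wz; apply: eq_bigr => k _; rewrite !mxE.
    by case: (w 0 k) => x y /=; rewrite mulr0 subr0.
  by case: (z) (w 0 j) => x y [x' y'] /=.
have Rb : b *m A = complex.Re z *: b + complex.Im z *: a.
  apply/rowP => j; move/rowP/(_ j)/(congr1 (@complex.Im R)): wz.
  rewrite !mxE raddf_sum /= => wz; transitivity (complex.Im (z * w 0 j)).
    rewrite -wz; apply: eq_bigr => k _; rewrite !mxE.
    by case: (w 0 k) => x y /=; rewrite mulr0 add0r.
  by case: (z) (w 0 j) => x y [x' y'] /=.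
have sym : (a *m A *m b^T) 0 0 = (b *m A *m a^T) 0 0.
  have -> : b *m A *m a^T = (a *m A *m b^T)^T.
    by rewrite !trmx_mul trmxK Asym mulmxA.
  by rewrite [RHS]mxE.
have ab : (a *m b^T) 0 0 = (b *m a^T) 0 0.
  have -> : b *m a^T = (a *m b^T)^T by rewrite trmx_mul trmxK.
  by rewrite [RHS]mxE.
have im0 : complex.Im z * (sqnorm a + sqnorm b) = 0.
  move: sym; rewrite Ra Rb !mulmxDl mulNmx -!scalemxAl !mxE /=.
  move: ab; rewrite !sqnormE !mxE => ->; lra.
have [Iz|Iz] := eqVneq (complex.Im z) 0.
  move: Ra Rb; rewrite Iz !scale0r subr0 addr0 => Ra Rb.
  have [a0|a0] := eqVneq a 0; last by exists a, (complex.Re z).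
  exists b, (complex.Re z); split=> //; apply: contraNneq w0 => b0.
  apply/eqP/rowP => j; move/rowP/(_ j): a0; move/rowP/(_ j): b0.
  by rewrite !mxE; case: (w 0 j) => x y /= -> ->.
move: im0 => /eqP; rewrite mulf_eq0 (negPf Iz) /= => /eqP im0.
have := sqnorm_ge0 a; have := sqnorm_ge0 b => b_ge0 a_ge0.
have a0 : a == 0 by rewrite -sqnorm_eq0; apply/eqP; lra.
have b0 : b == 0 by rewrite -sqnorm_eq0; apply/eqP; lra.
case/eqP: w0; apply/rowP => j.
move/eqP/rowP/(_ j): a0; move/eqP/rowP/(_ j): b0.
by rewrite !mxE; case: (w 0 j) => x y /= -> ->.
Qed.

(* A Householder reflection exchanging the first basis vector and [v]. *)
Lemma orthogonal_first_row n (v : 'rV[R]_n.+1) : sqnorm v = 1 ->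
  exists H : 'M[R]_n.+1, H *m H^T = 1%:M /\ delta_mx 0 0 *m H = v.
Proof.
move=> v1; pose e : 'rV[R]_n.+1 := delta_mx 0 0.
have [->|ve] := eqVneq v e.
  by exists 1%:M; rewrite trmx1 !mulmx1.
pose u := v - e; pose s := sqnorm u.
have s0 : s != 0 by rewrite sqnorm_eq0 subr_eq0.
have uu : u *m u^T = s%:M by rewrite [LHS]mx11_scalar -sqnormE.
have e1 : sqnorm e = 1.
  rewrite /sqnorm (bigD1 0) //= big1 ?addr0 ?mxE ?eqxx ?expr1n // => j j0.
  by rewrite mxE eqxx (negPf j0) expr0n.
have eu : e *m u^T = (- (s / 2))%:M.
  rewrite [LHS]mx11_scalar; congr (_%:M).
  have ex (x : 'rV[R]_n.+1) : (e *m x^T) 0 0 = x 0 0.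
    by rewrite -rowE !mxE.
  have -> : s = 2 - 2 * v 0 0.
    rewrite /s sqnormE /u raddfB /= mulmxBl !mulmxBr.
    have ve' : (v *m e^T) 0 0 = v 0 0.
      by rewrite -(ex v) -[v in LHS]trmxK -trmx_mul mxE.
    have vv : (v *m v^T) 0 0 = 1 by rewrite -sqnormE.
    have ee : (e *m e^T) 0 0 = 1 by rewrite -sqnormE.
    rewrite (_ : forall M N P Q : 'M[R]_1, (M - N - (P - Q)) 0 0 =
      M 0 0 - N 0 0 - (P 0 0 - Q 0 0)); last by move=> *; rewrite !mxE.
    by rewrite vv ee ex ve'; ring.
  by rewrite ex !mxE eqxx /=; field.
pose P := u^T *m u; pose H := 1%:M - (2 / s) *: P.
have PP : P *m P = s *: P.
  by rewrite /P -mulmxA (mulmxA u) uu mul_scalar_mx -scalemxAr.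
have HT : H^T = H by rewrite /H linearB linearZ /= trmx_mul trmxK trmx1.
exists H; split.
  rewrite HT /H mulmxBl mul1mx mulmxBr mulmx1 -scalemxAl -scalemxAr PP !scalerA.
  rewrite (_ : 2 / s * (2 / s) * s = 2 / s + 2 / s); last by field.
  by rewrite scalerDl opprB addrK subrK.
rewrite -/e /H mulmxBr mulmx1 -scalemxAr /P mulmxA eu mul_scalar_mx scalerA.
rewrite (_ : 2 / s * - (s / 2) = -1); last by field.
by rewrite scaleN1r opprK addrC subrK.
Qed.

(** Induction on the dimension: in an orthogonal basis starting with a unit eigenvector, the first
    row of the matrix vanishes off the diagonal, symmetry clears the first column, and a smaller
    symmetric block remains. *)
Theorem symmetric_spectral n (A : 'M[R]_n) : A^T = A ->
  exists (V : 'M[R]_n) (d : 'rV[R]_n),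
    V *m V^T = 1%:M /\ A = V^T *m diag_mx d *m V.
Proof.
elim: n A => [|n IHn] A Asym.
  by exists 1%:M, 0; split; [rewrite trmx1 mulmx1|apply/matrixP => -[]].
have [v [a [v0 va]]] := symmetric_eigenvector (ltn0Sn n) Asym.
have vp : 0 < sqnorm v by rewrite sqnorm_gt0.
pose v1 := (Num.sqrt (sqnorm v))^-1 *: v.
have v1n : sqnorm v1 = 1.
  rewrite /sqnorm (eq_bigr (fun j => (sqnorm v)^-1 * v 0 j ^+ 2)).
    by rewrite -mulr_sumr mulVf // gt_eqF.
  by move=> j _; rewrite mxE exprMn exprVn sqr_sqrtr // ltW.
have v1a : v1 *m A = a *: v1 by rewrite /v1 -scalemxAl va !scalerA mulrC.
have [H [HH eH]] := orthogonal_first_row v1n.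
have HH' : H^T *m H = 1%:M by apply: mulmx1C.
pose B : 'M[R]_(1 + n) := H *m A *m H^T.
have Bsym : B^T = B by rewrite /B !trmx_mul trmxK Asym mulmxA.
have B0 : row 0 B = a *: delta_mx 0 0.
  rewrite rowE /B !mulmxA (eH : delta_mx 0 0 *m H = v1) v1a -eH -scalemxAl.
  by rewrite -mulmxA HH mulmx1.
have [V [d [VV dE]]] : exists (V : 'M[R]_n) (d : 'rV[R]_n),
    V *m V^T = 1%:M /\ drsubmx B = V^T *m diag_mx d *m V.
  by apply: IHn; rewrite trmx_drsub Bsym.
have B0j (j : 'I_(1 + n)) : B (lshift n 0) j = a * (j == lshift n 0)%:R.
  have -> : lshift n 0 = 0 :> 'I_(1 + n) by apply: val_inj.
  by move/rowP/(_ j): B0; rewrite [LHS]mxE => ->; rewrite !mxE.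
have Bur : ursubmx B = 0.
  by apply/matrixP => i j; rewrite ord1 [LHS]mxE [LHS]mxE B0j eq_rlshift mulr0 mxE.
have Bul : ulsubmx B = a%:M.
  by rewrite [LHS]mx11_scalar [X in X%:M]mxE [X in X%:M]mxE B0j eqxx mulr1.
have Bdl : dlsubmx B = 0 by rewrite -[LHS]trmxK trmx_dlsub Bsym Bur trmx0.
pose W : 'M[R]_(1 + n) := block_mx 1%:M 0 0 V.
have BE : B = W^T *m diag_mx (row_mx a%:M d) *m W.
  rewrite -[LHS]submxK Bul Bur Bdl dE /W diag_mx_row tr_block_mx !trmx0 trmx1.
  rewrite !mulmx_block !(mul0mx, mulmx0, addr0, add0r, mul1mx, mulmx1).
  congr (block_mx _ _ _ _); apply/matrixP => i j.
  by rewrite !ord1 !mxE eqxx mulr1n.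
have WW : W *m W^T = 1%:M.
  rewrite /W tr_block_mx mulmx_block !trmx0 trmx1.
  by rewrite !(mul0mx, mulmx0, addr0, add0r, mul1mx) VV -scalar_mx_block.
exists (W *m H), (row_mx a%:M d); split.
  by rewrite trmx_mul -mulmxA (mulmxA H) HH mul1mx; exact: WW.
transitivity (H^T *m B *m H); last by rewrite BE trmx_mul !mulmxA.
by rewrite /B !mulmxA HH' mul1mx -mulmxA HH' mulmx1.
Qed.

End SpectralTheorem.

(** * Bernoulli sampling of subsets *)

Section BernoulliSampling.
Variables (R : realFieldType) (I : finType).
Implicit Types (p q : R) (f g : {set I} -> R).

Definition bern_weight p (T : {set I}) : R :=
  \prod_i (if i \in T then p else 1 - p).

Definition bernE p f : R := \sum_T bern_weight p T * f T.

Lemma bern_weightE p (T : {set I}) :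
  bern_weight p T = p ^+ #|T| * (1 - p) ^+ (#|I| - #|T|).
Proof.
rewrite /bern_weight (bigID (mem T)) /=; congr (_ * _).
  by rewrite (eq_bigr (fun=> p)) ?prodr_const // => i ->.
rewrite (eq_bigr (fun=> 1 - p)); last by move=> i /negPf ->.
rewrite (eq_bigl (fun i => i \in ~: T)) => [|i]; last by rewrite inE.
by rewrite prodr_const [in LHS]cardsCs setCK.
Qed.

Lemma bern_weight_ge0 p T : 0 <= p <= 1 -> 0 <= bern_weight p T.
Proof.
by move=> /andP[p0 p1]; apply: prodr_ge0 => i _; case: ifP => _; rewrite ?subr_ge0.
Qed.

Lemma eq_bernE p f g : f =1 g -> bernE p f = bernE p g.
Proof. by move=> fg; apply: eq_bigr => T _; rewrite fg. Qed.

Lemma bernE_le p f g : 0 <= p <= 1 -> (forall T, f T <= g T) ->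
  bernE p f <= bernE p g.
Proof.
by move=> p01 fg; apply: ler_sum => T _; rewrite ler_wpM2l ?bern_weight_ge0.
Qed.

Lemma bernED p f g : bernE p (fun T => f T + g T) = bernE p f + bernE p g.
Proof. by rewrite -big_split; apply: eq_bigr => T _; rewrite mulrDr. Qed.

Lemma bernEZ p c f : bernE p (fun T => c * f T) = c * bernE p f.
Proof. by rewrite mulr_sumr; apply: eq_bigr => T _; rewrite mulrCA. Qed.

Lemma bernE_sum p (J : finType) (P : pred J) (F : J -> {set I} -> R) :
  bernE p (fun T => \sum_(j | P j) F j T) = \sum_(j | P j) bernE p (F j).
Proof. by rewrite exchange_big; apply: eq_bigr => T _; rewrite mulr_sumr. Qed.

Lemma bernE_prod p (a b : I -> R) :
  bernE p (fun T => \prod_i (if i \in T then a i else b i)) =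
  \prod_i (p * a i + (1 - p) * b i).
Proof.
rewrite bigA_distr; apply: eq_bigr => T _; rewrite -big_split.
by apply: eq_bigr => i _ /=; case: ifP.
Qed.

Lemma bernE1 p : bernE p (fun=> 1) = 1.
Proof.
transitivity (\prod_(i : I) (p * 1 + (1 - p) * 1)); last first.
  by rewrite big1 // => i _; rewrite !mulr1 subrKC.
rewrite -bernE_prod; apply: eq_bernE => T.
by rewrite big1 // => i _; rewrite if_same.
Qed.

Lemma bernE_cst p c : bernE p (fun=> c) = c.
Proof.
transitivity (bernE p (fun=> c * 1)); first by rewrite mulr1.
by rewrite bernEZ bernE1 mulr1.
Qed.

Lemma bernE_full f : bernE 1 f = f setT.
Proof.
rewrite /bernE (bigD1 setT) //= big1 => [|T TN].
  by rewrite addr0 /bern_weight big1 ?mul1r // => i _; rewrite inE.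
have /subsetPn[i _ iT] : ~~ (setT \subset T) by rewrite subTset.
by rewrite /bern_weight (bigD1 i) //= (negPf iT) subrr !mul0r.
Qed.

(** Two independent samplings in succession act as one at the product rate; this is what allows a
    low rate to be reached by halvings. *)
Lemma bernE_setI p q f :
  bernE p (fun T => bernE q (fun S => f (T :&: S))) = bernE (p * q) f.
Proof.
pose a (b : bool) : R := b%:R.
(* The event that [T :&: S] equals [U] is a product of one factor per index, so the expectations
   over [S] and then over [T] factor by independence. *)
have fE T S : f (T :&: S) = \sum_U f U *
    \prod_i (if i \in S then a ((i \in T) == (i \in U)) else a (i \notin U)).
  rewrite (bigD1 (T :&: S)) //= [X in _ + X]big1 ?addr0.
    by rewrite big1 ?mulr1 // => i _; rewrite !inE; case: (i \in S); rewrite ?andbT ?eqxx ?andbF.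
  move=> U; rewrite eq_sym => /eqP/setP UN.
  have /existsP[i iP] : [exists i, (i \in T :&: S) != (i \in U)].
    by apply/existsPn => H; apply: UN => i; apply/eqP/negbNE/H.
  rewrite (bigD1 i) //= (_ : (if _ then _ else _) = 0) ?mul0r ?mulr0 //.
  move: iP; rewrite !inE; case: (i \in S); rewrite ?andbT ?andbF /a.
    by move=> /negPf ->.
  by case: (i \in U).
transitivity (\sum_U f U * bern_weight (p * q) U); last first.
  by apply: eq_bigr => U _; rewrite mulrC.
under eq_bernE => T do under eq_bernE => S do rewrite fE.
under eq_bernE => T do (rewrite bernE_sum; under eq_bigr => U _ do rewrite bernEZ bernE_prod).
rewrite bernE_sum; apply: eq_bigr => U _; rewrite bernEZ; congr (_ * _).
pose c i := q * a (true == (i \in U)) + (1 - q) * a (i \notin U).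
pose d i := q * a (false == (i \in U)) + (1 - q) * a (i \notin U).
transitivity (bernE p (fun T => \prod_i (if i \in T then c i else d i))).
  by apply: eq_bernE => T; apply: eq_bigr => i _; case: (i \in T).
rewrite bernE_prod; apply: eq_bigr => i _; rewrite /c /d /a.
by case: (i \in U) => /=; ring.
Qed.

(** Conditioning on every index but i: the product is the weight of [T] away from i. *)
Lemma bernE_cond p (i : I) f : bernE p f =
  \sum_(T : {set I} | i \notin T) (\prod_(j | j != i) (if j \in T then p else 1 - p)) *
     (p * f (i |: T) + (1 - p) * f T).
Proof.
rewrite /bernE (bigID (fun T : {set I} => i \in T)) /=.
rewrite (reindex_onto (fun T => i |: T) (fun T => T :\ i)) /=; last first.
  by move=> T iT; rewrite setD1K.
rewrite (eq_bigl (fun T : {set I} => i \notin T)); last first.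
  move=> T; rewrite setU11 /=; apply/eqP/idP => [<-|iT].
    by rewrite !inE eqxx.
  by rewrite setU1K.
rewrite -big_split; apply: eq_bigr => T iT /=.
rewrite /bern_weight (bigD1 i) //= setU11 [in X in _ + X](bigD1 i) //= (negPf iT).
rewrite (eq_bigr (fun j => if j \in T then p else 1 - p)); last first.
  by move=> j ji; rewrite !inE (negPf ji).
by ring.
Qed.

Lemma bernE_supset p (A : {set I}) : bernE p (fun T => (A \subset T)%:R) = p ^+ #|A|.
Proof.
transitivity (bernE p (fun T => \prod_i (if i \in T then 1 else (i \notin A)%:R))).
  apply: eq_bernE => T; case: (boolP (A \subset T)) => AT.
    rewrite big1 // => i _; case: ifPn => // iT.
    by rewrite (contra (subsetP AT i)).
  have /subsetPn[i iA iT] := AT.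
  by rewrite (bigD1 i) //= (negPf iT) iA mul0r.
rewrite bernE_prod (bigID (mem A)) /= [X in _ * X]big1 => [|i ->]; last first.
  by rewrite !mulr1 subrKC.
rewrite !mulr1 (eq_bigr (fun=> p)) ?prodr_const // => i ->.
by rewrite mulr0 addr0.
Qed.

Lemma card_sum_mem (T : {set I}) : #|T|%:R = \sum_i ([set i] \subset T)%:R :> R.
Proof.
rewrite -sum1_card natr_sum big_mkcond /=; apply: eq_bigr => i _.
by rewrite sub1set; case: (i \in T).
Qed.

Lemma bernE_card p : bernE p (fun T => #|T|%:R) = p * #|I|%:R.
Proof.
under eq_bernE => T do rewrite card_sum_mem.
rewrite bernE_sum (eq_bigr (fun=> p)) => [|i _]; last by rewrite bernE_supset cards1 expr1.
by rewrite sumr_const mulr_natr.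
Qed.

(** The square counts ordered pairs of kept indices: a diagonal pair has probability p, a pair of
    distinct indices p^2. *)
Lemma bernE_card_sqr p : 0 <= p <= 1 ->
  bernE p (fun T => #|T|%:R ^+ 2) <= p * #|I|%:R + (p * #|I|%:R) ^+ 2.
Proof.
move=> /andP[p0 p1].
have -> : bernE p (fun T => #|T|%:R ^+ 2) = \sum_(i : I) \sum_(j : I) p ^+ #|[set i; j]|.
  transitivity (bernE p (fun T => \sum_(i : I) \sum_(j : I) ([set i; j] \subset T)%:R)).
    apply: eq_bernE => T; rewrite card_sum_mem expr2 mulr_suml.
    apply: eq_bigr => i _; rewrite mulr_sumr; apply: eq_bigr => j _.
    by rewrite -natrM mulnb subUset.
  rewrite bernE_sum; apply: eq_bigr => i _; rewrite bernE_sum.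
  by apply: eq_bigr => j _; rewrite bernE_supset.
have -> : p * #|I|%:R + (p * #|I|%:R) ^+ 2 = \sum_(i : I) (p + \sum_(j : I) p ^+ 2).
  rewrite !sumr_const -[LHS]addr0 -[RHS]mulr_natr -[p ^+ 2 *+ _]mulr_natr; ring.
apply: ler_sum => i _; rewrite (bigD1 i) //= setUid cards1 expr1 lerD2l.
rewrite [leRHS](bigD1 i) //= -[leLHS]add0r lerD ?sqr_ge0 //.
by apply: ler_sum => j ji; rewrite cards2 eq_sym ji.
Qed.

End BernoulliSampling.

(** * Trace moments of sampled Gram matrices *)

Section QuadraticForms.
Variable R : rcfType.

Definition qform n (P : 'M[R]_n) (x : 'rV[R]_n) : R := (x *m P *m x^T) 0 0.

Lemma qform_diag n (d : 'rV[R]_n) (x : 'rV[R]_n) :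
  qform (diag_mx d) x = \sum_j d 0 j * x 0 j ^+ 2.
Proof.
rewrite /qform mul_mx_diag mxE; apply: eq_bigr => j _.
by rewrite !mxE mulrC mulrA -expr2 mulrC.
Qed.

Lemma qform_conj n (P V : 'M[R]_n) (x : 'rV[R]_n) :
  qform (V^T *m P *m V) x = qform P (x *m V^T).
Proof. by rewrite /qform trmx_mul trmxK !mulmxA. Qed.

Lemma sqnorm_orthogonal n (V : 'M[R]_n) (x : 'rV[R]_n) : V *m V^T = 1%:M ->
  sqnorm (x *m V) = sqnorm x.
Proof.
by move=> VV; rewrite !sqnormE trmx_mul -mulmxA (mulmxA V) VV mul1mx.
Qed.

Lemma sqnorm_orthogonalT n (V : 'M[R]_n) (x : 'rV[R]_n) : V *m V^T = 1%:M ->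
  sqnorm (x *m V^T) = sqnorm x.
Proof. by move=> VV; apply: sqnorm_orthogonal; rewrite trmxK; apply: mulmx1C. Qed.

Lemma spectral_exp n (V : 'M[R]_n) (d : 'rV[R]_n) m : V *m V^T = 1%:M ->
  (V^T *m diag_mx d *m V) ^+ m = V^T *m diag_mx (\row_j d 0 j ^+ m) *m V.
Proof.
move=> VV; elim: m => [|m IHm].
  rewrite expr0 (_ : diag_mx _ = 1%:M) ?mulmx1 ?(mulmx1C VV) //.
  by apply/matrixP => i j; rewrite !mxE expr0.
rewrite exprS IHm -[LHS]/(_ *m _) -!mulmxA (mulmxA V V^T) VV mul1mx !mulmxA.
rewrite -(mulmxA V^T) mulmx_diag; congr (_ *m diag_mx _ *m _).
by apply/rowP => j; rewrite !mxE exprS.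
Qed.

Lemma mxtrace_spectral n (V : 'M[R]_n) (d : 'rV[R]_n) : V *m V^T = 1%:M ->
  \tr (V^T *m diag_mx d *m V) = \sum_j d 0 j.
Proof. by move=> VV; rewrite mxtrace_mulC mulmxA VV mul1mx mxtrace_diag. Qed.

Lemma qform_spectral_exp n (V : 'M[R]_n) (d : 'rV[R]_n) m x : V *m V^T = 1%:M ->
  qform ((V^T *m diag_mx d *m V) ^+ m) x =
  \sum_j d 0 j ^+ m * (x *m V^T) 0 j ^+ 2.
Proof.
move=> VV; rewrite spectral_exp // qform_conj qform_diag.
by apply: eq_bigr => j _; rewrite mxE.
Qed.

Lemma qform_exp_ge0 n (P : 'M[R]_n) m x : P^T = P -> ~~ odd m -> 0 <= qform (P ^+ m) x.
Proof.
move=> /symmetric_spectral[V [d [VV ->]]] m_even; rewrite qform_spectral_exp //.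
by apply: sumr_ge0 => j _; rewrite mulr_ge0 ?sqr_ge0 // exprn_even_ge0.
Qed.

Lemma mxtrace_exp_ge0 n (P : 'M[R]_n) m : P^T = P -> ~~ odd m -> 0 <= \tr (P ^+ m).
Proof.
move=> /symmetric_spectral[V [d [VV ->]]] m_even.
rewrite spectral_exp // mxtrace_spectral //.
by apply: sumr_ge0 => j _; rewrite mxE exprn_even_ge0.
Qed.

(** The larger of |x| and |y|, raised to the full degree, already dominates the product; the even
    degree removes the absolute values. *)
Lemma exprM_le_sum (x y : R) j l : ~~ odd (j + l) ->
  x ^+ j * y ^+ l <= x ^+ (j + l) + y ^+ (j + l).
Proof.
move=> jl_even; apply: le_trans (ler_norm _) _; rewrite normrM !normrX.
have nE (z : R) : z ^+ (j + l) = `|z| ^+ (j + l).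
  by rewrite -normrX ger0_norm // exprn_even_ge0.
rewrite (nE x) (nE y); have [xy|/ltW yx] := leP `|x| `|y|.
  rewrite -[leLHS]add0r lerD ?exprn_ge0 //.
  by rewrite exprD ler_wpM2r ?exprn_ge0 // lerXn2r ?nnegrE.
rewrite -[leLHS]addr0 lerD ?exprn_ge0 //.
by rewrite exprD ler_wpM2l ?exprn_ge0 // lerXn2r ?nnegrE.
Qed.

(** P and Q need not commute. Expanding over pairs of eigenvectors, one from each basis, reduces the
    claim to [exprM_le_sum], weighted by products of squared coordinates of x. *)
Lemma qform_expM_le n (P Q : 'M[R]_n) x j l : P^T = P -> Q^T = Q -> ~~ odd (j + l) ->
  qform (P ^+ j) x * qform (Q ^+ l) x <=
  sqnorm x * (qform (P ^+ (j + l)) x + qform (Q ^+ (j + l)) x).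
Proof.
move=> /symmetric_spectral[V [d [VV ->]]] /symmetric_spectral[U [e [UU ->]]] jl.
rewrite !qform_spectral_exp //.
set a := x *m V^T; set b := x *m U^T.
have -> : sqnorm x * (\sum_k d 0 k ^+ (j + l) * a 0 k ^+ 2 +
    \sum_k e 0 k ^+ (j + l) * b 0 k ^+ 2) =
  \sum_k \sum_h (d 0 k ^+ (j + l) + e 0 h ^+ (j + l)) * (a 0 k ^+ 2 * b 0 h ^+ 2).
  rewrite mulrDr -{1}(sqnorm_orthogonalT x UU) -(sqnorm_orthogonalT x VV) -/a -/b.
  rewrite mulrC !mulr_suml -big_split; apply: eq_bigr => k _ /=.
  by rewrite !mulr_sumr -big_split; apply: eq_bigr => h _ /=; ring.
rewrite mulr_suml; apply: ler_sum => k _; rewrite mulr_sumr; apply: ler_sum => h _.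
rewrite (_ : _ * _ * _ = d 0 k ^+ j * e 0 h ^+ l * (a 0 k ^+ 2 * b 0 h ^+ 2)).
  by rewrite ler_wpM2r ?exprM_le_sum // mulr_ge0 ?sqr_ge0.
by ring.
Qed.

Lemma exprB_telescope n (P Q : 'M[R]_n) m :
  P ^+ m.+1 - Q ^+ m.+1 = \sum_(j < m.+1) P ^+ j * (P - Q) * Q ^+ (m - j).
Proof.
elim: m => [|m IHm].
  by rewrite big_ord1 !expr1 !expr0 mul1r mulr1.
rewrite big_ord_recl expr0 mul1r subn0.
under eq_bigr => j _ do rewrite lift0 subSS exprS -!mulrA.
rewrite -mulr_sumr; under eq_bigr => j _ do rewrite mulrA.
by rewrite -IHm mulrBr mulrBl -!exprS [RHS]addrC addrA subrK.
Qed.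

(** In the telescoped difference of powers, the rank-one factor splits each term into a product of
    two quadratic forms of total degree m, to which [qform_expM_le] applies. *)
Lemma qform_rank1_update n (P Q : 'M[R]_n) (x : 'rV[R]_n) (c : R) m :
  P^T = P -> Q^T = Q -> 0 <= c -> P - Q = c *: (x^T *m x) -> ~~ odd m ->
  qform (P ^+ m.+1) x - qform (Q ^+ m.+1) x <=
  c * m.+1%:R * sqnorm x * (qform (P ^+ m) x + qform (Q ^+ m) x).
Proof.
move=> Psym Qsym c0 PQ m_even.
have -> : qform (P ^+ m.+1) x - qform (Q ^+ m.+1) x =
    \sum_(j < m.+1) c * (qform (P ^+ j) x * qform (Q ^+ (m - j)) x).
  transitivity (qform (P ^+ m.+1 - Q ^+ m.+1) x).
    by rewrite /qform mulmxBr mulmxBl !mxE.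
  rewrite exprB_telescope /qform mulmx_sumr mulmx_suml summxE.
  apply: eq_bigr => j _; rewrite PQ -[_ * _ * _]/(_ *m _ *m _).
  rewrite -scalemxAr -scalemxAl -scalemxAr -scalemxAl mxE; congr (_ * _).
  have -> : x *m (P ^+ j *m (x^T *m x) *m Q ^+ (m - j)) *m x^T =
      (x *m P ^+ j *m x^T) *m (x *m Q ^+ (m - j) *m x^T) by rewrite !mulmxA.
  by rewrite [LHS]mxE big_ord1.
apply: (@le_trans _ _ (\sum_(j < m.+1) c *
    (sqnorm x * (qform (P ^+ m) x + qform (Q ^+ m) x)))).
  apply: ler_sum => j _; rewrite ler_wpM2l //.
  have jm : (j + (m - j))%N = m by rewrite subnKC // -ltnS.
  by have := @qform_expM_le n P Q x j (m - j)%N Psym Qsym; rewrite jm; apply.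
by rewrite sumr_const card_ord -[X in X <= _]mulr_natr le_eqVlt; apply/orP; left; apply/eqP; ring.
Qed.

Lemma mxtrace_mul_gram n m (X : 'M[R]_(m, n)) (N : 'M[R]_n) (d : 'rV[R]_m) :
  \tr (X^T *m diag_mx d *m X *m N) = \sum_i d 0 i * qform N (row i X).
Proof.
rewrite -!mulmxA mxtrace_mulC -!mulmxA; apply: eq_bigr => i _.
rewrite mul_diag_mx mxE; congr (_ * _).
rewrite /qform -row_mul mulmxA [LHS]mxE [RHS]mxE.
by apply: eq_bigr => j _; rewrite !mxE.
Qed.

End QuadraticForms.

(** * Khintchine-type bounds for trace moments under sampling *)

Section MomentBound.
Variables (R : rcfType) (n : nat) (X : 'M[R]_n) (theta : R).
Hypothesis theta_half : 1 / 2 <= theta <= 1.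
Implicit Types (T : {set 'I_n}).

(** The diagonal of D - I for the rescaling matrix D; every entry has mean zero at rate [theta]. *)
Definition sample_dev T : 'rV[R]_n := \row_i ((i \in T)%:R / theta - 1).

Definition dev_gram T : 'M[R]_n := X^T *m diag_mx (sample_dev T) *m X.

Lemma dev_gram_sym T : (dev_gram T)^T = dev_gram T.
Proof. by rewrite /dev_gram !trmx_mul trmxK tr_diag_mx mulmxA. Qed.

Lemma dev_gramU1 i T : i \notin T ->
  dev_gram (i |: T) - dev_gram T = theta^-1 *: ((row i X)^T *m row i X).
Proof.
move=> iT; rewrite /dev_gram -mulmxBl -mulmxBr.
have -> : diag_mx (sample_dev (i |: T)) - diag_mx (sample_dev T) =
    theta^-1 *: ((delta_mx 0 i)^T *m (delta_mx 0 i : 'rV_n)).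
  rewrite trmx_delta mul_delta_mx; apply/matrixP => j k; rewrite !mxE !inE.
  have [->|ji] := eqVneq j i.
    by rewrite (negPf iT) /= eq_sym; case: (k == i); rewrite ?mulr1n ?mulr0n /=; ring.
  by rewrite /= addrN mulr0.
by rewrite -scalemxAr -scalemxAl rowE trmx_mul !mulmxA.
Qed.

(** A discrete integration by parts: since the deviation at i has mean zero, only the change of f
    when i is added to the sample survives. *)
Lemma bernE_dev i (f : {set 'I_n} -> R) :
  bernE theta (fun T => sample_dev T 0 i * f T) =
  \sum_(T : {set 'I_n} | i \notin T)
     (\prod_(j | j != i) (if j \in T then theta else 1 - theta)) *
     ((1 - theta) * (f (i |: T) - f T)).
Proof.
rewrite (bernE_cond _ i); apply: eq_bigr => T iT; congr (_ * _).
rewrite !mxE setU11 (negPf iT) mul0r /=; field.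
by apply/eqP => t0; move: theta_half; rewrite t0; lra.
Qed.

(** One factor of the power is expanded over the indices. Integrating its coefficient by parts and
    applying the rank-one update bound leaves a moment two degrees lower, weighted by the Gram
    matrix X^T X. *)
Lemma mxtrace_moment_step (L : R) m : (forall i, sqnorm (row i X) <= L) -> ~~ odd m ->
  bernE theta (fun T => \tr (dev_gram T ^+ m.+2)) <=
  2 * m.+1%:R * L * bernE theta (fun T => \tr (X^T *m X *m dev_gram T ^+ m)).
Proof.
move=> HL m_even; have /andP[th0 th1] := theta_half.
have -> : bernE theta (fun T => \tr (dev_gram T ^+ m.+2)) =
    \sum_i bernE theta (fun T => sample_dev T 0 i * qform (dev_gram T ^+ m.+1) (row i X)).
  rewrite -bernE_sum; apply: eq_bernE => T.
  by rewrite exprS -[_ * _]/(_ *m _) {1}/dev_gram mxtrace_mul_gram.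
have -> : bernE theta (fun T => \tr (X^T *m X *m dev_gram T ^+ m)) =
    \sum_i bernE theta (fun T => qform (dev_gram T ^+ m) (row i X)).
  rewrite -bernE_sum; apply: eq_bernE => T.
  have -> : X^T *m X = X^T *m diag_mx (const_mx 1) *m X by rewrite diag_const_mx mulmx1.
  by rewrite mxtrace_mul_gram; apply: eq_bigr => i _; rewrite mxE mul1r.
rewrite mulr_sumr; apply: ler_sum => i _.
rewrite bernE_dev -bernEZ (bernE_cond _ i); apply: ler_sum => T iT.
rewrite ler_wpM2l ?prodr_ge0 // => [j _|]; first by case: ifP => _; lra.
set P := dev_gram (i |: T); set Q := dev_gram T.
have th_inv : 0 <= theta^-1 by rewrite invr_ge0; lra.
have := qform_rank1_update (dev_gram_sym _) (dev_gram_sym _) th_inv (dev_gramU1 iT) m_even.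
rewrite -/P -/Q.
set p := qform (P ^+ m) _; set q := qform (Q ^+ m) _.
have p0 : 0 <= p by apply: qform_exp_ge0 => //; apply: dev_gram_sym.
have q0 : 0 <= q by apply: qform_exp_ge0 => //; apply: dev_gram_sym.
move=> upd; apply: (@le_trans _ _ ((1 - theta) * (theta^-1 * m.+1%:R * L * (p + q)))).
  apply: ler_wpM2l; first lra.
  apply: le_trans upd _; apply: ler_wpM2r; first exact: addr_ge0.
  by apply: ler_wpM2l => //; rewrite mulr_ge0.
have L0 : 0 <= L by apply: le_trans (HL i); apply: sqnorm_ge0.
pose c := m.+1%:R * L; have c0 : 0 <= c by rewrite mulr_ge0.
(* Sets containing i carry weight [theta], the others 1 - [theta]. The factor (1 - theta) / theta is
   at most 2 theta and at most 2 (1 - theta) because theta >= 1/2. *)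
rewrite (_ : _ * _ = (1 - theta) / theta * (c * p) + (1 - theta) / theta * (c * q)); last first.
  by rewrite /c; ring.
rewrite (_ : theta * _ + _ = 2 * theta * (c * p) + 2 * (1 - theta) * (c * q)); last first.
  by rewrite /c; ring.
by apply: lerD; apply: ler_wpM2r; rewrite ?mulr_ge0 // ler_pdivrMr; nra.
Qed.

(** Iterates the previous step. Since X^T X is diagonal with entries at most [kap], each round costs
    a factor 4 q L kap; the last one leaves the trace of X^T X, so that [K] takes the place of the
    dimension. *)
Lemma mxtrace_moment (w : 'rV[R]_n) (L kap K : R) q :
  (forall i, sqnorm (row i X) <= L) -> 0 <= L ->
  X^T *m X = diag_mx w -> (forall j, w 0 j <= kap) -> \sum_j w 0 j <= kap * K -> 0 <= K ->
  0 <= kap -> (0 < q)%N ->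
  bernE theta (fun T => \tr (dev_gram T ^+ (2 * q))) <= (4 * q%:R * L * kap) ^+ q * K.
Proof.
move=> HL L0 Xw wk wK K0 kap0 q0.
have th01 : 0 <= theta <= 1 by move: theta_half => /andP[??]; apply/andP; split=> //; lra.
(* The factor stays frozen at the final [q]: round r contributes 2 (2 r + 1), which is at most 4 q
   for r < q. *)
suff H r : (0 < r <= q)%N ->
    bernE theta (fun T => \tr (dev_gram T ^+ (2 * r))) <= (4 * q%:R * L * kap) ^+ r * K.
  by apply: H; rewrite q0 leqnn.
elim: r => // r IHr /= rq.
have m_even : ~~ odd (2 * r) by rewrite mul2n odd_double.
rewrite (_ : (2 * r.+1 = (2 * r).+2)%N); last by rewrite mulnS.
apply: le_trans (mxtrace_moment_step HL m_even) _.
have c0 : 0 <= 2 * (2 * r).+1%:R * L by rewrite !mulr_ge0.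
have cq : 2 * (2 * r).+1%:R * L <= 4 * q%:R * L.
  apply: ler_wpM2r => //; rewrite -!natrM ler_nat; lia.
have [->|r0] := posnP r.
  rewrite muln0 (@eq_bernE _ _ _ _ (fun=> \sum_j w 0 j)) => [|T]; last first.
    by rewrite expr0 Xw -[diag_mx w *m 1]/(_ * 1) mulr1 mxtrace_diag.
  rewrite bernE_cst expr1; apply: le_trans (ler_wpM2l _ wK) _; first by rewrite !mulr_ge0.
  rewrite mulrA; apply: ler_wpM2r => //; apply: ler_wpM2r => //; apply: ler_wpM2r => //.
  by rewrite -!natrM ler_nat; lia.
rewrite [in leRHS]exprS -[leRHS]mulrA; set Y := _ ^+ r * K.
have Y0 : 0 <= Y by rewrite !mulr_ge0 ?exprn_ge0 // !mulr_ge0.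
apply: (@le_trans _ _ (2 * (2 * r).+1%:R * L * (kap * Y))); last first.
  by rewrite -[leRHS]mulrA ler_wpM2r // mulr_ge0.
apply: ler_wpM2l => //; apply: le_trans (ler_wpM2l kap0 (IHr _)).
  rewrite -bernEZ; apply: bernE_le => // T.
  rewrite Xw mulr_sumr; apply: ler_sum => j _.
  rewrite mul_diag_mx mxE ler_wpM2r //.
  have -> : (dev_gram T ^+ (2 * r)) j j = qform (dev_gram T ^+ (2 * r)) (delta_mx 0 j).
    by rewrite /qform -rowE trmx_delta -colE !mxE.
  by apply: qform_exp_ge0 => //; apply: dev_gram_sym.
by rewrite r0 ltnW.
Qed.

End MomentBound.

(** * Weighted deviations and eigenvalue comparison *)

Section WeightedDeviation.
Variables (R : rcfType) (n : nat).

Definition spectral_dec (A V : 'M[R]_n) (l : 'I_n -> R) : Prop :=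
  V *m V^T = 1%:M /\ A = V^T *m diag_mx (\row_j l j) *m V.

Lemma spectral_dec_qform A V l (x : 'rV[R]_n) : spectral_dec A V l ->
  qform A x = \sum_j l j * (x *m V^T) 0 j ^+ 2.
Proof.
move=> [VV ->]; rewrite qform_conj qform_diag.
by apply: eq_bigr => j _; rewrite mxE.
Qed.

(** Both sides are the i-th diagonal entry of A^2. This turns row bounds on A into row bounds on the
    weighted eigenbasis. *)
Lemma spectral_dec_row A V l i : spectral_dec A V l ->
  \sum_j l j ^+ 2 * V j i ^+ 2 = \sum_j A i j ^+ 2.
Proof.
move=> [VV ->]; transitivity (sqnorm (row i (V^T *m diag_mx (\row_j l j) *m V))).
  rewrite row_mul sqnorm_orthogonal //; apply: eq_bigr => j _.
  by rewrite mul_mx_diag !mxE; ring.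
by apply: eq_bigr => j _; rewrite mxE.
Qed.

(** Scaled so that its Gram matrix X^T X is the diagonal matrix of the weights. *)
Definition weighted_basis (V : 'M[R]_n) (w : 'I_n -> R) : 'M[R]_n :=
  V^T *m diag_mx (\row_j Num.sqrt (w j)).

(* By Markov's inequality, the event that this quantity is at least 1 has
   probability at most its expectation; on the complement, every eigenvalue of
   the weighted deviation matrix is at most 1/2 in absolute value. *)
Definition dev_gauge (V : 'M[R]_n) (w : 'I_n -> R) (theta : R) (q : nat) (T : {set 'I_n}) : R :=
  4 ^+ q * \tr (dev_gram (weighted_basis V w) theta T ^+ (2 * q)).

Lemma dev_gauge_ge0 V w theta q T : 0 <= dev_gauge V w theta q T.
Proof.
rewrite mulr_ge0 ?exprn_ge0 // mxtrace_exp_ge0 ?dev_gram_sym //.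
by rewrite mul2n odd_double.
Qed.

(** With z_j = y_j / sqrt(w_j), the deviation form at y V becomes the quadratic form of the weighted
    deviation matrix at z, and the squared norm of z is the sum on the right. Where w_j = 0 the
    quotients are 0 by convention, consistently with y_j = 0. *)
Lemma dev_gauge_bound V w theta q T (y : 'rV[R]_n) : (0 < q)%N ->
  (forall j, 0 <= w j) -> dev_gauge V w theta q T < 1 ->
  (forall j, w j = 0 -> y 0 j = 0) ->
  `|\sum_i sample_dev theta T 0 i * (y *m V) 0 i ^+ 2| <= 1 / 2 * \sum_j y 0 j ^+ 2 / w j.
Proof.
move=> q0 w0 g1 yw; pose z : 'rV[R]_n := \row_j (y 0 j / Num.sqrt (w j)).
have zX : z *m (weighted_basis V w)^T = y *m V.
  rewrite trmx_mul trmxK tr_diag_mx mulmxA mul_mx_diag; congr (_ *m _).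
  apply/rowP => j; rewrite !mxE; have [wj|wj] := eqVneq (w j) 0.
    by rewrite yw // !mul0r.
  by rewrite mulfVK // sqrtr_eq0 -ltNge lt_def wj w0.
have zn : sqnorm z = \sum_j y 0 j ^+ 2 / w j.
  by apply: eq_bigr => j _; rewrite mxE expr_div_n sqr_sqrtr.
have -> : \sum_i sample_dev theta T 0 i * (y *m V) 0 i ^+ 2 =
    qform (dev_gram (weighted_basis V w) theta T) z.
  rewrite -zX; move: (weighted_basis V w) => W.
  by rewrite -qform_diag /qform /dev_gram trmx_mul trmxK !mulmxA.
rewrite -zn; move: g1; rewrite /dev_gauge.
have [U [d [UU ->]]] := symmetric_spectral (dev_gram_sym (weighted_basis V w) theta T).
rewrite spectral_exp // mxtrace_spectral // => g1.
rewrite qform_conj qform_diag.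
have dj j : `|d 0 j| <= 1 / 2.
  rewrite leNgt; apply/negP => dj; move: g1; apply/negP; rewrite -leNgt.
  rewrite mulr_sumr (bigD1 j) //= mxE exprM -exprMn.
  rewrite -[leLHS]addr0 lerD //.
    apply: exprn_ege1; rewrite -[d 0 j ^+ 2]ger0_norm ?sqr_ge0 // normrX; nra.
  apply: sumr_ge0 => k _; rewrite mxE; apply: mulr_ge0; first exact: exprn_ge0.
  by rewrite exprn_even_ge0 // mul2n odd_double.
apply: le_trans (ler_norm_sum _ _ _) _.
rewrite -(sqnorm_orthogonalT z UU) mulr_sumr; apply: ler_sum => j _.
by rewrite normrM [X in _ * X]ger0_norm ?sqr_ge0 // ler_wpM2r ?sqr_ge0.
Qed.

(** The bound w <= c l^2 limits the rows of the weighted basis by c a on S and makes them vanish off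
    S; the bound w <= kap limits them by kap. The moment bound then gives (16 q c a kap)^q K, and
    512 = 16 * 32. *)
Lemma bernE_dev_gauge A V l w theta q (S : {set 'I_n}) (a c kap K : R) :
  1 / 2 <= theta <= 1 -> (0 < q)%N -> spectral_dec A V l ->
  (forall i, \sum_j A i j ^+ 2 <= if i \in S then a else 0) -> #|S|%:R <= K ->
  (forall j, 0 <= w j <= kap) -> (forall j, w j <= c * l j ^+ 2) ->
  0 <= a -> 0 <= c -> 0 <= kap -> 512 * q%:R * (c * a) * kap <= 1 ->
  bernE theta (dev_gauge V w theta q) <= K * (1 / 32) ^+ q.
Proof.
move=> th q0 Adec rowA SK wk wc a0 c0 kap0 small; have [VV _] := Adec.
pose X := weighted_basis V w.
have rowX i : sqnorm (row i X) = \sum_j w j * V j i ^+ 2.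
  apply: eq_bigr => j _; rewrite mxE /X /weighted_basis mul_mx_diag !mxE exprMn.
  by rewrite sqr_sqrtr 1?[LHS]mulrC //; case/andP: (wk j).
have rowXa i : sqnorm (row i X) <= if i \in S then c * a else 0.
  rewrite rowX; apply: (@le_trans _ _ (c * \sum_j A i j ^+ 2)).
    rewrite -(spectral_dec_row i Adec) mulr_sumr; apply: ler_sum => j _.
    by rewrite mulrA ler_wpM2r ?sqr_ge0.
  by move: (rowA i) => /(ler_wpM2l c0); case: ifP; rewrite // mulr0.
have rowXk i : sqnorm (row i X) <= kap.
  rewrite rowX; have -> : kap = \sum_j kap * V j i ^+ 2.
    rewrite -mulr_sumr; have /matrixP/(_ i i) := mulmx1C VV.
    rewrite !mxE eqxx /= mulr1n => VVi; rewrite -[LHS]mulr1 -VVi; congr (_ * _).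
    by apply: eq_bigr => j _; rewrite mxE expr2.
  by apply: ler_sum => j _; rewrite ler_wpM2r ?sqr_ge0 //; case/andP: (wk j).
have XX : X^T *m X = diag_mx (\row_j w j).
  rewrite /X /weighted_basis trmx_mul trmxK tr_diag_mx -mulmxA (mulmxA V) VV mul1mx.
  rewrite mulmx_diag; congr diag_mx; apply/rowP => j.
  by rewrite !mxE -expr2 sqr_sqrtr //; case/andP: (wk j).
have sumw : \sum_j (\row_j w j) 0 j <= kap * K.
  rewrite -mxtrace_diag -XX mxtrace_mulC.
  have -> : \tr (X *m X^T) = \sum_i sqnorm (row i X).
    apply: eq_bigr => i _; rewrite mxE; apply: eq_bigr => j _.
    by rewrite !mxE expr2.
  apply: (@le_trans _ _ (\sum_(i in S) kap)).
    rewrite [leRHS]big_mkcond /=; apply: ler_sum => i _.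
    by move: (rowXa i) (rowXk i); case: ifP.
  by rewrite sumr_const -[leLHS]mulr_natr ler_wpM2l.
have K0 : 0 <= K by apply: le_trans SK.
rewrite bernEZ; apply: le_trans (ler_wpM2l _ (_ : _ <= (4 * q%:R * (c * a) * kap) ^+ q * K)) _.
- exact: exprn_ge0.
- apply: (@mxtrace_moment _ _ _ _ th (\row_j w j)) => //.
  + by move=> i; apply: le_trans (rowXa i) _; case: ifP => // _; apply: mulr_ge0.
  + exact: mulr_ge0.
  + by move=> j; rewrite mxE; case/andP: (wk j).
rewrite [leLHS]mulrA -[X in X * K <= _]exprMn [leLHS]mulrC; apply: ler_wpM2l => //.
by apply: lerXn2r; rewrite ?nnegrE; [rewrite !mulr_ge0|lra|lra].
Qed.

End WeightedDeviation.

(** * Min-max comparison of sampled eigenvalues with a threshold *)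

Section EigenvalueComparison.
Variables (R : rcfType) (n : nat).
Variables (A V : 'M[R]_n) (l : 'I_n -> R).
Variables (e : 'rV[R]_n) (U : 'M[R]_n) (m : 'I_n -> R).
Hypothesis Adec : spectral_dec A V l.
Hypothesis Bdec : spectral_dec (diag_mx e *m A *m diag_mx e) U m.
Hypothesis e2 : forall i, e 0 i ^+ 2 <= 2.
Hypothesis m_sorted : forall i j : 'I_n, (i <= j)%N -> m j <= m i.

Lemma exists_row_ker (C : 'M[R]_n) (i : 'I_n) : (forall k, C k i = 0) ->
  exists2 x : 'rV[R]_n, x != 0 & x *m C = 0.
Proof.
move=> Ci; apply/det0P; rewrite (expand_det_col _ i) big1 // => k _.
by rewrite Ci mul0r.
Qed.

Let VV : V *m V^T = 1%:M := Adec.1.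
Let UU : U *m U^T = 1%:M := Bdec.1.

Let sqnorm_diag (x : 'rV[R]_n) : sqnorm (x *m diag_mx e) = \sum_i e 0 i ^+ 2 * x 0 i ^+ 2.
Proof. by apply: eq_bigr => i _; rewrite mul_mx_diag mxE exprMn mulrC. Qed.

Let sqnorm_diag_le (x : 'rV[R]_n) : sqnorm (x *m diag_mx e) <= 2 * sqnorm x.
Proof.
rewrite sqnorm_diag mulr_sumr; apply: ler_sum => i _.
by rewrite ler_wpM2r ?sqr_ge0.
Qed.

Let qform_sampled (x : 'rV[R]_n) : qform (diag_mx e *m A *m diag_mx e) x =
  \sum_j l j * (x *m diag_mx e *m V^T) 0 j ^+ 2.
Proof.
rewrite -(spectral_dec_qform _ Adec) /qform trmx_mul tr_diag_mx.
by rewrite !mulmxA.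
Qed.

Let sqnorm_split (y : 'rV[R]_n) : sqnorm (y *m V *m diag_mx e) =
  sqnorm y + \sum_i (e 0 i ^+ 2 - 1) * (y *m V) 0 i ^+ 2.
Proof.
rewrite sqnorm_diag -(sqnorm_orthogonal y VV) -big_split; apply: eq_bigr => i _ /=.
by ring.
Qed.

(** A Courant-Fischer argument: on the test vector x the sampled form is at least m_i |x|^2.
    Eigenvalues of A outside [N] contribute at most 2 g |x|^2, as the rescaling at most doubles
    squared norms; those in [N] contribute at most t |x|^2 by the assumed form inequality. *)
Lemma sampled_eig_upper (i : 'I_n) (t g : R) (N : pred 'I_n) : 0 < t -> 0 <= g ->
  (forall j, N j -> (i <= j)%N && (0 < l j)) ->
  (forall j : 'I_n, (i <= j)%N -> ~~ N j -> l j <= g) ->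
  (forall y : 'rV[R]_n, (forall j, ~~ N j -> y 0 j = 0) ->
     \sum_i (e 0 i ^+ 2 - 1) * (y *m V) 0 i ^+ 2 <= \sum_j y 0 j ^+ 2 * (t / l j - 1)) ->
  m i <= t + 2 * g.
Proof.
move=> t0 g0 NP NnP hF.
(* There are only n - 1 constraints on x: those of index below i kill the large
   eigenvalues of A, and those above i put x in the span of the first
   eigenvectors of the sampled matrix.  Column i of C is void. *)
pose C : 'M[R]_n := \matrix_(k, j) if (j < i)%N then (diag_mx e *m V^T) k j
   else if j == i then 0 else U^T k j.
have [x x0 xC] : exists2 x : 'rV[R]_n, x != 0 & x *m C = 0.
  by apply: (@exists_row_ker C i) => k; rewrite mxE ltnn eqxx.
pose a := x *m diag_mx e *m V^T; pose b := x *m U^T.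
have a0 (j : 'I_n) : (j < i)%N -> a 0 j = 0.
  move=> ji; move/rowP/(_ j): xC; rewrite [in RHS]mxE => <-.
  by rewrite /a -mulmxA !mxE; apply: eq_bigr => k _; rewrite [C _ _]mxE ji.
have b0 (j : 'I_n) : (i < j)%N -> b 0 j = 0.
  move=> ij; move/rowP/(_ j): xC; rewrite [in RHS]mxE => <-.
  rewrite /b !mxE; apply: eq_bigr => k _; rewrite [C _ _]mxE ltnNge (ltnW ij) /=.
  by rewrite -(inj_eq val_inj) gtn_eqF.
have xp : 0 < sqnorm x by rewrite sqnorm_gt0.
have low : m i * sqnorm x <= qform (diag_mx e *m A *m diag_mx e) x.
  rewrite (spectral_dec_qform _ Bdec) -(sqnorm_orthogonalT x UU) mulr_sumr.
  apply: ler_sum => j _; have [ij|ji] := ltnP i j.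
    by rewrite -/b b0 // expr0n !mulr0.
  by rewrite ler_wpM2r ?sqr_ge0 // m_sorted.
(* With this [y], expanding |x - y V diag(e)|^2 >= 0 and applying [hF] cancels the |y|^2 terms and
   leaves exactly the bound on the [N]-part. *)
pose y : 'rV[R]_n := \row_j (if N j then l j * a 0 j / t else 0).
have yN j : ~~ N j -> y 0 j = 0 by rewrite mxE => /negPf ->.
have ay : \sum_(j | N j) l j * a 0 j ^+ 2 <= t * sqnorm x.
  have /(_ y yN) := hF.
  have := sqnorm_ge0 (x - y *m V *m diag_mx e).
  have -> : sqnorm (x - y *m V *m diag_mx e) =
      sqnorm x - 2 * (\sum_j a 0 j * y 0 j) + sqnorm (y *m V *m diag_mx e).
    have -> : \sum_j a 0 j * y 0 j = \sum_j x 0 j * (y *m V *m diag_mx e) 0 j.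
      transitivity ((a *m y^T) 0 0).
        by rewrite mxE; apply: eq_bigr => j _; rewrite !mxE.
      have -> : a *m y^T = x *m (y *m V *m diag_mx e)^T.
        by rewrite !trmx_mul tr_diag_mx /a !mulmxA.
      by rewrite [LHS]mxE; apply: eq_bigr => j _; rewrite [in LHS]mxE.
    set z := y *m V *m diag_mx e; transitivity
        (\sum_j (x 0 j ^+ 2 - 2 * (x 0 j * z 0 j) + z 0 j ^+ 2)); last first.
      by rewrite big_split sumrB -mulr_sumr.
    by apply: eq_bigr => j _; rewrite !mxE; ring.
  rewrite sqnorm_split.
  set F := \sum_i (e 0 i ^+ 2 - 1) * _ => h1 h2.
  have h3 : sqnorm y + \sum_j y 0 j ^+ 2 * (t / l j - 1) - 2 * (\sum_j a 0 j * y 0 j) =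
     - (\sum_(j | N j) l j * a 0 j ^+ 2) / t.
    rewrite mulr_sumr /sqnorm -big_split -sumrB mulNr mulr_suml -sumrN [RHS]big_mkcond /=.
    apply: eq_bigr => j _; rewrite mxE; case: ifP => [Nj|_]; last by ring.
    have /andP[_ lj] := NP j Nj; field.
    by rewrite (gt_eqF lj) (gt_eqF t0).
  rewrite -ler_pdivrMl // mulrC; move: h1 h2 h3; rewrite mulNr; lra.
have rest : \sum_(j | ~~ N j) l j * a 0 j ^+ 2 <= 2 * g * sqnorm x.
  apply: (@le_trans _ _ (g * sqnorm a)); last first.
    rewrite /a sqnorm_orthogonalT //; have := sqnorm_diag_le x; nra.
  rewrite /sqnorm mulr_sumr big_mkcond /=; apply: ler_sum => j _.
  case: ifP => Nj; last by rewrite mulr_ge0 ?sqr_ge0.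
  have [ij|ji] := leqP i j; first by rewrite ler_wpM2r ?sqr_ge0 ?NnP.
  by rewrite a0 // expr0n !mulr0.
have : qform (diag_mx e *m A *m diag_mx e) x <= (t + 2 * g) * sqnorm x.
  by rewrite qform_sampled -/a (bigID N) /= mulrDl lerD.
by move=> /(le_trans low); rewrite ler_pM2r.
Qed.

(** The test vector is x = y V diag(e), orthogonal to the sampled eigenvectors of index below i, so
    the sampled form at x is at most m_i |x|^2. Positivity of the assumed form says that |x|^2
    exceeds t times the sum of y_j^2 / l_j, which pushes the [J]-part above t |x|^2. *)
Lemma sampled_eig_lower (i : 'I_n) (t g : R) (J : pred 'I_n) : 0 < t -> 0 <= g ->
  (forall j : 'I_n, (j <= i)%N -> J j && (0 < l j)) ->
  (forall j : 'I_n, (i < j)%N -> J j -> l j < 0) ->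
  (forall j : 'I_n, ~~ J j -> - g <= l j) ->
  (forall y : 'rV[R]_n, y != 0 -> (forall j, ~~ J j -> y 0 j = 0) ->
     0 < \sum_j y 0 j ^+ 2 * (1 - t / l j) + \sum_i (e 0 i ^+ 2 - 1) * (y *m V) 0 i ^+ 2) ->
  t - 2 * g <= m i.
Proof.
move=> t0 g0 Jlow Jneg Jn hF.
(* Again n - 1 constraints, now on y.  For j > i in J they say that a_j, the
   j-th coordinate below, equals t y_j / l_j, the value for which
   l_j a_j^2 >= 2 t a_j y_j - t^2 y_j^2 / l_j is an equality; this inequality
   would otherwise fail, since l_j < 0. *)
pose G : 'M[R]_n := V *m diag_mx e *m diag_mx e *m V^T.
pose C : 'M[R]_n := \matrix_(k, j) if (j < i)%N then (V *m diag_mx e *m U^T) k j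
   else if j == i then 0 else if J j then G k j - t / l j * (k == j)%:R else (k == j)%:R.
have [y y0 yC] : exists2 y : 'rV[R]_n, y != 0 & y *m C = 0.
  by apply: (@exists_row_ker C i) => k; rewrite mxE ltnn eqxx.
pose x := y *m V *m diag_mx e.
pose a := x *m diag_mx e *m V^T; pose b := x *m U^T.
have ysum (j : 'I_n) : \sum_k y 0 k * (k == j)%:R = y 0 j.
  rewrite (bigD1 j) //= eqxx mulr1 big1 ?addr0 // => k /negPf ->.
  by rewrite mulr0.
have yCj (j : 'I_n) : \sum_k y 0 k * C k j = 0.
  by move/rowP/(_ j): yC; rewrite !mxE.
have b0 (j : 'I_n) : (j < i)%N -> b 0 j = 0.
  move=> ji; rewrite -[RHS](yCj j) /b /x -!mulmxA mxE.
  by apply: eq_bigr => k _; rewrite [C _ _]mxE ji !mulmxA.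
have Cout (j k : 'I_n) : (i < j)%N ->
    C k j = if J j then G k j - t / l j * (k == j)%:R else (k == j)%:R.
  by move=> ij; rewrite mxE ltnNge (ltnW ij) /= -(inj_eq val_inj) gtn_eqF.
have yn (j : 'I_n) : ~~ J j -> y 0 j = 0.
  move=> Jj; have [ji|ij] := leqP j i; first by case/andP: (Jlow j ji) => Jj'; rewrite Jj' in Jj.
  rewrite -(ysum j) -[RHS](yCj j); apply: eq_bigr => k _.
  by rewrite Cout // (negPf Jj).
have an (j : 'I_n) : (i < j)%N -> J j -> a 0 j = t / l j * y 0 j.
  move=> ij Jj; apply/eqP; rewrite -subr_eq0 -(yCj j) -(ysum j) mulr_sumr.
  rewrite /a /x -!mulmxA mxE -sumrB; apply/eqP/eq_bigr => k _.
  by rewrite Cout // Jj /G -!mulmxA; ring.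
have up : qform (diag_mx e *m A *m diag_mx e) x <= m i * sqnorm x.
  rewrite (spectral_dec_qform _ Bdec) -(sqnorm_orthogonalT x UU) mulr_sumr.
  apply: ler_sum => j _; have [ij|ji] := leqP i j.
    by rewrite ler_wpM2r ?sqr_ge0 // m_sorted.
  by rewrite -/b b0 // expr0n !mulr0.
have xa : sqnorm x = \sum_j a 0 j * y 0 j.
  rewrite sqnormE {2}/x !trmx_mul tr_diag_mx.
  rewrite (_ : x *m (diag_mx e *m (V^T *m y^T)) = a *m y^T); last by rewrite /a !mulmxA.
  by rewrite [LHS]mxE; apply: eq_bigr => j _; rewrite [y^T _ _]mxE.
have yJ : \sum_(j | J j) l j * a 0 j ^+ 2 >=
    \sum_j (2 * t * (a 0 j * y 0 j) - t ^+ 2 * (y 0 j ^+ 2 / l j)).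
  rewrite [leRHS]big_mkcond /=; apply: ler_sum => j _.
  case: ifPn => Jj; last by rewrite yn // expr0n !(mulr0, mul0r) subr0.
  have [ji|ij] := leqP j i.
    have /andP[_ lj] := Jlow j ji.
    rewrite -subr_ge0 (_ : _ - _ = (l j * a 0 j - t * y 0 j) ^+ 2 / l j).
      by rewrite divr_ge0 ?sqr_ge0 // ltW.
    by field; rewrite gt_eqF.
  rewrite an // le_eqVlt; apply/orP; left; apply/eqP; field.
  by rewrite lt_eqF // Jneg.
have rest : - (2 * g * sqnorm x) <= \sum_(j | ~~ J j) l j * a 0 j ^+ 2.
  apply: (@le_trans _ _ (- (g * sqnorm a))).
    rewrite lerN2 /a sqnorm_orthogonalT //; have := sqnorm_diag_le x; nra.
  rewrite /sqnorm -mulNr mulr_sumr [leRHS]big_mkcond /=; apply: ler_sum => j _.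
  case: ifP => Jj; first by rewrite ler_wpM2r ?sqr_ge0 ?Jn.
  by rewrite mulNr oppr_le0 mulr_ge0 ?sqr_ge0.
have pos := hF y y0 yn.
have lt1 : (t - 2 * g) * sqnorm x < m i * sqnorm x.
  apply: lt_le_trans up; rewrite qform_sampled -/a (bigID J) /=.
  have s1 : sqnorm x = sqnorm y + \sum_i (e 0 i ^+ 2 - 1) * (y *m V) 0 i ^+ 2.
    exact: sqnorm_split.
  have s2 : \sum_j (2 * t * (a 0 j * y 0 j) - t ^+ 2 * (y 0 j ^+ 2 / l j)) =
      t * sqnorm x + t * (sqnorm x - t * \sum_j (y 0 j ^+ 2 / l j)).
    rewrite sumrB -!mulr_sumr -xa; ring.
  have s3 : \sum_j y 0 j ^+ 2 * (1 - t / l j) = sqnorm y - t * \sum_j (y 0 j ^+ 2 / l j).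
    by rewrite mulr_sumr -sumrB; apply: eq_bigr => j _; ring.
  rewrite s3 in pos; rewrite s2 in yJ; nra.
(* The rescaling could annihilate y V; the strict inequality just proved fails at x = 0 and so
   excludes this. *)
have xp : 0 < sqnorm x.
  rewrite lt_def sqnorm_ge0 andbT; apply: contraTneq lt1 => ->.
  by rewrite !mulr0 ltxx.
by move: lt1; rewrite ltr_pM2r // => /ltW.
Qed.

End EigenvalueComparison.

(** * One sampling step with rate at least 1/2 *)

Section SupDistance.
Variables (R : realFieldType) (n : nat).
Implicit Types u v w : 'I_n -> R.

Definition sup_dist u v : R := \big[Num.max/0]_i `|u i - v i|.

Lemma sup_dist_ge u v i : `|u i - v i| <= sup_dist u v.
Proof. exact: le_bigmax. Qed.

Lemma sup_dist_le u v c : 0 <= c -> (forall i, `|u i - v i| <= c) -> sup_dist u v <= c.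
Proof. by move=> c0 H; apply: bigmax_le => // i _. Qed.

Lemma sup_dist_ge0 u v : 0 <= sup_dist u v.
Proof. exact: bigmax_ge_id. Qed.

Lemma sup_dist_triangle u v w : sup_dist u w <= sup_dist u v + sup_dist v w.
Proof.
apply: sup_dist_le => [|i]; first by rewrite addr_ge0 ?sup_dist_ge0.
have -> : u i - w i = (u i - v i) + (v i - w i) by ring.
by apply: le_trans (ler_normD _ _) _; rewrite lerD ?sup_dist_ge.
Qed.

End SupDistance.

(* The typical error is at most 5 g with g^2 = 512 q a; the term 36 accounts for
   the exceptional samples. *)
Definition step_const (R : rcfType) : R := 25 * 512 + 36.

Section OneStep.
Variables (R : rcfType) (n : nat).

Definition nonincreasing (l : 'I_n -> R) : Prop :=
  forall i j : 'I_n, (i <= j)%N -> l j <= l i.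

Definition sampling_diag (theta : R) (T : {set 'I_n}) : 'M[R]_n :=
  diag_mx (\row_i (if i \in T then (Num.sqrt theta)^-1 else 0)).

(** Kept at size n, with zero rows and columns off [T]: successive samples then share one index
    type, and the padding zeros of the algorithm are already in the spectrum. *)
Definition sampled (theta : R) (A : 'M[R]_n) (T : {set 'I_n}) : 'M[R]_n :=
  sampling_diag theta T *m A *m sampling_diag theta T.

Lemma sampledE theta A T i j : 0 <= theta ->
  sampled theta A T i j = if (i \in T) && (j \in T) then A i j / theta else 0.
Proof.
move=> th; rewrite /sampled mul_mx_diag mul_diag_mx !mxE.
case: (i \in T); case: (j \in T); rewrite /= ?(mul0r, mulr0) //.
by rewrite mulrC mulrA -invfM -expr2 sqr_sqrtr // mulrC.
Qed.

Lemma sum_sqr_eig A V (l : 'I_n -> R) : spectral_dec A V l ->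
  \sum_j l j ^+ 2 = \sum_i \sum_j A i j ^+ 2.
Proof.
move=> Adec; under [RHS]eq_bigr => i _ do rewrite -(spectral_dec_row i Adec).
rewrite exchange_big; apply: eq_bigr => j _ /=.
rewrite -mulr_sumr; have /matrixP/(_ j j) := Adec.1.
rewrite !mxE eqxx /= mulr1n => VVj; rewrite -[LHS]mulr1 -VVj; congr (_ * _).
by apply: eq_bigr => i _; rewrite mxE expr2.
Qed.

(** Transfers bounds on positive eigenvalues to negative ones; reversing the indices restores the
    non-increasing order. *)
Lemma spectral_dec_opp A V (l : 'I_n -> R) : spectral_dec A V l ->
  spectral_dec (- A) (\matrix_(i, j) V (rev_ord i) j) (fun i => - l (rev_ord i)).
Proof.
move=> [VV AE]; split.
  apply/matrixP => i j; move/matrixP/(_ (rev_ord i) (rev_ord j)): VV.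
  rewrite !mxE (inj_eq rev_ord_inj) => <-.
  by apply: eq_bigr => k _; rewrite !mxE.
apply/matrixP => i j; rewrite [LHS]mxE AE !mxE (reindex_inj rev_ord_inj) -sumrN.
apply: eq_bigr => k _; rewrite !mul_mx_diag !mxE.
by ring.
Qed.

Lemma nonincreasing_opp l : nonincreasing l -> nonincreasing (fun i => - l (rev_ord i)).
Proof. by move=> ls i j ij; rewrite lerN2; apply: ls; rewrite /= leq_sub2l. Qed.

Lemma ratio_bounds (x D b h : R) : 0 < h -> 0 < b -> 0 <= x -> 0 < D ->
  x * h <= b * D -> h * b <= x * D ->
  [/\ 0 <= x / D, x / D <= b / h & x / D <= 1 / (h * b) * x ^+ 2].
Proof.
move=> h0 b0 x0 D0 xh hb; split; first by rewrite divr_ge0 // ltW.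
  by rewrite ler_pdivrMr // mulrAC ler_pdivlMr.
rewrite -subr_ge0 (_ : _ - _ = x * (x * D - h * b) / (h * b * D)).
  by rewrite divr_ge0 ?mulr_ge0 ?subr_ge0 // ltW // mulr_gt0.
by field; rewrite !gt_eqF.
Qed.

(** * Eigenvalue bounds on the positive side *)

Section Side.
Variables (A V : 'M[R]_n) (l : 'I_n -> R) (S : {set 'I_n}).
Variables (a K theta g : R) (q : nat).
Hypothesis Adec : spectral_dec A V l.
Hypothesis l_sorted : nonincreasing l.
Hypothesis rowA : forall i, \sum_j A i j ^+ 2 <= if i \in S then a else 0.
Hypothesis SK : #|S|%:R <= K.
Hypothesis theta_half : 1 / 2 <= theta <= 1.
Hypothesis a_ge0 : 0 <= a.
Hypothesis q_gt0 : (0 < q)%N.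
Hypothesis g_gt0 : 0 < g.
Hypothesis small : 512 * q%:R * a <= g ^+ 2.

Let K_ge0 : 0 <= K. Proof. exact: le_trans SK. Qed.

(** The reciprocal of t / l_j - 1 at the threshold t = l_i + g, and 0 outside the set [N] of
    [sampled_eig_upper]. *)
Definition upper_weight (i j : 'I_n) : R :=
  if (i <= j)%N && (g <= l j) then l j / (l i + g - l j) else 0.

(** The reciprocal of 1 - t / l_j at t = l_i - g, and 0 outside the set [J] of
    [sampled_eig_lower]. *)
Definition lower_weight (i j : 'I_n) : R :=
  if (j <= i)%N || (l j <= - g) then l j / (l j - (l i - g)) else 0.

Lemma upper_weight_bound i j : g <= l i ->
  [/\ 0 <= upper_weight i j, upper_weight i j <= l i / g &
      upper_weight i j <= 1 / (g * l i) * l j ^+ 2].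
Proof.
move=> gi; have g0 := g_gt0; have li : 0 < l i by apply: lt_le_trans gi.
rewrite /upper_weight; case: ifPn => [/andP[ij gj]|_]; last first.
  by split=> //; [exact/ltW/divr_gt0 | rewrite mulr_ge0 ?sqr_ge0 // ltW // divr_gt0 // mulr_gt0].
have lji := l_sorted ij; have lj : 0 < l j by apply: lt_le_trans gj.
have D : 0 < l i + g - l j by lra.
(* On the interval from g to l_i, the concave function l_j (l_i + g - l_j) is at least its common
   value g l_i at both ends. *)
by apply: ratio_bounds => //; [exact: ltW | nra | nra].
Qed.

Lemma lower_weight_bound i j : 2 * g <= l i ->
  [/\ 0 <= lower_weight i j, lower_weight i j <= l i / g &
      lower_weight i j <= 1 / (g * l i) * l j ^+ 2].
Proof.
move=> gi; have g0 := g_gt0; have li : 0 < l i by lra.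
rewrite /lower_weight; case: ifPn => [|_]; last first.
  by split=> //; [exact/ltW/divr_gt0 | rewrite mulr_ge0 ?sqr_ge0 // ltW // divr_gt0 // mulr_gt0].
have [ij _|ij /= gj] := leqP j i.
  have lij := l_sorted ij; have lj : 0 < l j by lra.
  have D : 0 < l j - (l i - g) by lra.
  by apply: ratio_bounds => //; [exact: ltW | nra | nra].
(* For l_j <= -g numerator and denominator are both negative, so the ratio is treated with both
   signs changed. *)
rewrite -mulrNN -invrN opprB -[l j ^+ 2]sqrrN.
by apply: ratio_bounds => //; [lra | lra | nra | nra].
Qed.

(** A union bound in additive form: the terms are nonnegative, so a sum below 1 puts every gauge
    below 1. *)
Definition side_gauge (T : {set 'I_n}) : R :=
  \sum_(i | g <= l i) dev_gauge V (upper_weight i) theta q T +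
  \sum_(i | 2 * g <= l i) dev_gauge V (lower_weight i) theta q T.

Lemma side_gauge_ge0 T : 0 <= side_gauge T.
Proof. by rewrite addr_ge0 ?sumr_ge0 // => i _; apply: dev_gauge_ge0. Qed.

Lemma sum_sqr_eig_le : \sum_j l j ^+ 2 <= K * a.
Proof.
rewrite (sum_sqr_eig Adec); apply: (@le_trans _ _ (\sum_(i in S) a)).
  rewrite [leRHS]big_mkcond; apply: ler_sum => i _; exact: rowA.
by rewrite sumr_const -[leLHS]mulr_natl ler_wpM2r.
Qed.

(** Each such eigenvalue takes at least g^2 >= a from a squared Frobenius norm of at most K a. The
    union bound thus has a number of terms controlled by [K], not by n. *)
Lemma card_large_eig : #|[pred i | g <= l i]|%:R <= K.
Proof.
have ag : a <= g ^+ 2.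
  apply: le_trans small; rewrite -[leLHS]mul1r ler_wpM2r // -natrM ler1n; lia.
rewrite -(ler_pM2r (_ : 0 < g ^+ 2)) ?exprn_gt0 //.
apply: (@le_trans _ _ (\sum_(i | g <= l i) g ^+ 2)).
  by rewrite sumr_const -[leRHS]mulr_natl.
apply: (@le_trans _ _ (\sum_j l j ^+ 2)).
  rewrite big_mkcond; apply: ler_sum => j _; case: ifP => [gj|_]; last exact: sqr_ge0.
  by rewrite lerXn2r ?nnegrE // ?(le_trans _ gj) // ltW.
by apply: le_trans sum_sqr_eig_le _; rewrite ler_wpM2l.
Qed.

Let dev_gauge_le w i : 0 < l i ->
  (forall j, [/\ 0 <= w j, w j <= l i / g & w j <= 1 / (g * l i) * l j ^+ 2]) ->
  bernE theta (dev_gauge V w theta q) <= K * (1 / 32) ^+ q.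
Proof.
move=> li H; have gl : 0 < g * l i by rewrite mulr_gt0.
apply: (bernE_dev_gauge (c := 1 / (g * l i)) (kap := l i / g) theta_half q_gt0 Adec rowA SK) => //.
- by move=> j; have [-> ->] := H j.
- by move=> j; have [] := H j.
- by rewrite divr_ge0 // ltW.
- by rewrite divr_ge0 // ltW.
- have -> : 512 * q%:R * (1 / (g * l i) * a) * (l i / g) = 512 * q%:R * a / g ^+ 2.
    by field; rewrite !gt_eqF.
  by rewrite ler_pdivrMr ?exprn_gt0 // mul1r.
Qed.

Lemma bernE_side_gauge : bernE theta side_gauge <= 2 * K ^+ 2 * (1 / 32) ^+ q.
Proof.
have c0 : 0 <= K * (1 / 32) ^+ q by rewrite mulr_ge0 // exprn_ge0 //; lra.
have card2 : #|[pred i | 2 * g <= l i]|%:R <= K.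
  apply: le_trans card_large_eig; rewrite ler_nat; apply: subset_leq_card.
  by apply/subsetP => i; rewrite !inE; have := g_gt0; lra.
rewrite bernED !bernE_sum (_ : 2 * K ^+ 2 * _ = K * (K * (1 / 32) ^+ q) + K * (K * (1 / 32) ^+ q)).
  apply: lerD.
    apply: le_trans (_ : \sum_(i | g <= l i) K * (1 / 32) ^+ q <= _).
      apply: ler_sum => i gi; apply: (@dev_gauge_le _ i) => [|j].
        exact: lt_le_trans gi.
      exact: upper_weight_bound.
    by rewrite sumr_const -[leLHS]mulr_natl ler_wpM2r // card_large_eig.
  apply: le_trans (_ : \sum_(i | 2 * g <= l i) K * (1 / 32) ^+ q <= _).
    apply: ler_sum => i gi; apply: (@dev_gauge_le _ i) => [|j].
      by have := g_gt0; lra.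
    exact: lower_weight_bound.
  by rewrite sumr_const -[leLHS]mulr_natl ler_wpM2r.
by ring.
Qed.

Variables (T : {set 'I_n}) (U : 'M[R]_n) (m : 'I_n -> R).
Hypothesis Bdec : spectral_dec (sampled theta A T) U m.
Hypothesis m_sorted : nonincreasing m.

Let e : 'rV[R]_n := \row_i (if i \in T then (Num.sqrt theta)^-1 else 0).

Let th_gt0 : 0 < theta. Proof. by have /andP[] := theta_half; lra. Qed.

Let e2 i : e 0 i ^+ 2 <= 2.
Proof.
rewrite mxE; case: ifP => _; last by rewrite expr0n.
rewrite exprVn sqr_sqrtr ?(ltW th_gt0) // -(ler_pM2r th_gt0) mulVf ?(gt_eqF th_gt0) //.
by have /andP[] := theta_half; lra.
Qed.

Let e2_dev i : e 0 i ^+ 2 - 1 = sample_dev theta T 0 i.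
Proof.
rewrite !mxE; case: ifP => _; last by rewrite expr0n mul0r.
by rewrite exprVn sqr_sqrtr ?(ltW th_gt0) // div1r.
Qed.

(** The threshold is t = max(l_i, 0) + g. If l_i < g, the set [N] is empty and the form inequality
    concerns only y = 0; otherwise the gauge of [upper_weight] supplies it. *)
Lemma side_upper i : side_gauge T < 1 -> m i <= Num.max (l i) 0 + 3 * g.
Proof.
move=> g1; set M := Num.max _ _.
have M0 : 0 <= M by rewrite le_max lexx orbT.
have lM : l i <= M by rewrite le_max lexx.
have -> : M + 3 * g = (M + g) + 2 * g by ring.
apply: (sampled_eig_upper Adec Bdec e2 m_sorted (N := fun j => (i <= j)%N && (g <= l j))).
- by have := g_gt0; lra.
- exact: ltW.
- by move=> j /andP[-> gj] /=; apply: lt_le_trans gj.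
- by move=> j ij; rewrite ij /= -ltNge => /ltW.
move=> y yN; have [gi|gi] := leP g (l i); last first.
  rewrite (_ : y = 0); last first.
    apply/rowP => j; rewrite mxE; apply: yN; rewrite negb_and -ltnNge -ltNge.
    by have [ij|//] := leqP i j; rewrite (le_lt_trans (l_sorted ij)).
  rewrite mul0mx big1 => [|j _]; last by rewrite [X in _ * X ^+ 2]mxE expr0n mulr0.
  by rewrite big1 // => j _; rewrite mxE expr0n mul0r.
have ME : M = l i by rewrite /M max_l // (le_trans (ltW g_gt0)).
under eq_bigr => k _ do rewrite e2_dev.
apply: le_trans (ler_norm _) _.
have w0 j : 0 <= upper_weight i j by have [] := upper_weight_bound j gi.
apply: le_trans (dev_gauge_bound q_gt0 w0 (_ : dev_gauge V (upper_weight i) theta q T < 1) _) _.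
- apply: le_lt_trans g1; rewrite /side_gauge (bigD1 i) //= -addrA lerDl addr_ge0 ?sumr_ge0 //;
    by move=> *; apply: dev_gauge_ge0.
- move=> j; rewrite /upper_weight; case: ifPn => [/andP[ij gj]|Nj _]; last exact: yN.
  have lji := l_sorted ij => /eqP.
  rewrite mulf_eq0 invr_eq0 (gt_eqF (lt_le_trans g_gt0 gj)) /= => /eqP.
  by have := g_gt0; lra.
apply: (@le_trans _ _ (\sum_j y 0 j ^+ 2 / upper_weight i j)).
  rewrite ler_piMl //; last lra.
  by apply: sumr_ge0 => j _; rewrite divr_ge0 ?sqr_ge0.
apply: ler_sum => j _; rewrite /upper_weight; case: ifPn => [/andP[ij gj]|Nj]; last first.
  by rewrite yN // expr0n !mul0r.
have lj := lt_le_trans g_gt0 gj; have lji := l_sorted ij.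
rewrite ME invfM invrK ler_wpM2l ?sqr_ge0 // le_eqVlt; apply/orP; left; apply/eqP.
by field; rewrite gt_eqF.
Qed.

(** The threshold is t = l_i - g. The factor 1/2 in [dev_gauge_bound] leaves at least half of a
    positive weighted sum, hence the strict positivity that [sampled_eig_lower] asks for. *)
Lemma side_lower i : side_gauge T < 1 -> 2 * g <= l i -> l i - 3 * g <= m i.
Proof.
move=> g1 gi; have li : 0 < l i by have := g_gt0; lra.
have -> : l i - 3 * g = (l i - g) - 2 * g by ring.
apply: (sampled_eig_lower Adec Bdec e2 m_sorted
          (J := fun j => (j <= i)%N || (l j <= - g))).
- by have := g_gt0; lra.
- exact: ltW.
- by move=> j ji; rewrite ji /=; apply: lt_le_trans (l_sorted ji).
- by move=> j ij; rewrite leqNgt ij /=; have := g_gt0; lra.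
- by move=> j; rewrite negb_or -ltNge => /andP[_ /ltW].
have w_gt0 (j : 'I_n) : (j <= i)%N || (l j <= - g) -> 0 < lower_weight i j.
  move=> Jj; rewrite /lower_weight Jj; have [ji|ij] := leqP j i.
    by have := l_sorted ji; have := g_gt0 => *; rewrite divr_gt0 //; lra.
  move: Jj; rewrite leqNgt ij /= => gj.
  by rewrite -mulrNN -invrN divr_gt0 //; have := g_gt0; lra.
move=> y y0 yJ; under [X in _ + X]eq_bigr => k _ do rewrite e2_dev.
have w0 j : 0 <= lower_weight i j by have [] := lower_weight_bound j gi.
have wE : \sum_j y 0 j ^+ 2 * (1 - (l i - g) / l j) = \sum_j y 0 j ^+ 2 / lower_weight i j.
  apply: eq_bigr => j _; case: (boolP ((j <= i)%N || (l j <= - g))) => Jj; last first.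
    by rewrite yJ // expr0n !mul0r.
  rewrite /lower_weight Jj invfM invrK; congr (_ * _); field.
  by apply/eqP => lj0; move: Jj => /orP[/l_sorted|]; rewrite lj0; have := g_gt0; lra.
have QF : `|\sum_k sample_dev theta T 0 k * (y *m V) 0 k ^+ 2| <=
    1 / 2 * \sum_j y 0 j ^+ 2 / lower_weight i j.
  apply: (dev_gauge_bound q_gt0 w0) => [|j wj].
    apply: le_lt_trans g1; rewrite /side_gauge [X in _ + X](bigD1 i) //=.
    rewrite addrCA lerDl addr_ge0 ?sumr_ge0 //;
    by move=> *; apply: dev_gauge_ge0.
  by apply: yJ; apply/negP => /w_gt0; rewrite wj ltxx.
rewrite wE; suff Q_gt0 : 0 < \sum_j y 0 j ^+ 2 / lower_weight i j.
  by move: QF Q_gt0; rewrite ler_norml => /andP[+ _]; lra.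
have /rV0Pn[j yj] := y0; rewrite (bigD1 j) //= ltr_wpDr //.
  by apply: sumr_ge0 => k _; rewrite divr_ge0 ?sqr_ge0.
rewrite divr_gt0 ?exprn_even_gt0 // w_gt0 //.
by apply: contraNT yj => /yJ ->.
Qed.

End Side.

(** * Expected squared error of one step *)

Section TwoSides.
Variables (A V : 'M[R]_n) (l : 'I_n -> R) (S : {set 'I_n}) (M : {set 'I_n} -> 'I_n -> R).
Variables (a theta : R) (K q : nat).
Hypothesis Adec : spectral_dec A V l.
Hypothesis l_sorted : nonincreasing l.
Hypothesis rowA : forall i, \sum_j A i j ^+ 2 <= if i \in S then a else 0.
Hypothesis SK : (#|S| <= K)%N.
Hypothesis theta_half : 1 / 2 <= theta <= 1.
Hypothesis a_gt0 : 0 < a.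
Hypothesis q_gt0 : (0 < q)%N.
Hypothesis K_gt0 : (0 < K)%N.
Hypothesis Kq : (K <= 2 ^ q)%N.
Hypothesis Mdec : forall T, exists U, spectral_dec (sampled theta A T) U (M T).
Hypothesis M_sorted : forall T, nonincreasing (M T).

(** For use on exceptional samples. Frobenius norms bound every |l_i| by s = sqrt(K a) and, since 1
    / theta^2 <= 4, every sampled eigenvalue by 2 s. *)
Lemma sup_dist_crude T : sup_dist (M T) l ^+ 2 <= 9 * (K%:R * a).
Proof.
have th_gt0 : 0 < theta by have /andP[] := theta_half; lra.
pose s := Num.sqrt (K%:R * a).
have s2 : s ^+ 2 = K%:R * a by rewrite sqr_sqrtr // mulr_ge0 // ltW.
have s0 : 0 <= s by apply: sqrtr_ge0.
have SKR : #|S|%:R <= K%:R :> R by rewrite ler_nat.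
have lA : \sum_j l j ^+ 2 <= K%:R * a := sum_sqr_eig_le Adec rowA SKR (ltW a_gt0).
have mA : \sum_j M T j ^+ 2 <= 4 * (K%:R * a).
  have [U Bdec] := Mdec T; rewrite (sum_sqr_eig Bdec).
  apply: le_trans (ler_wpM2l _ lA) => //; rewrite (sum_sqr_eig Adec) mulr_sumr.
  apply: ler_sum => i _; rewrite mulr_sumr; apply: ler_sum => j _.
  rewrite sampledE ?(ltW th_gt0) //; case: ifP => _; last by rewrite expr0n /= mulr_ge0 ?sqr_ge0.
  rewrite expr_div_n ler_pdivrMr ?exprn_gt0 //.
  have := sqr_ge0 (A i j); set x := A i j ^+ 2 => x0.
  have /andP[h1 h2] := theta_half; have t2 : 1 <= 4 * theta ^+ 2 by nra.
  by rewrite mulrAC -[leLHS]mul1r ler_wpM2r.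
rewrite (_ : 9 * (K%:R * a) = (3 * s) ^+ 2); last by rewrite exprMn s2; ring.
rewrite lerXn2r ?nnegrE ?sup_dist_ge0 ?mulr_ge0 //.
apply: sup_dist_le => [|i]; first exact: mulr_ge0.
have li : `|l i| <= s.
  rewrite -(ler_pXn2r (_ : 0 < 2)%N) ?nnegrE // -normrX ger0_norm ?sqr_ge0 // s2.
  apply: le_trans lA; rewrite (bigD1 i) //= lerDl sumr_ge0 // => j _.
  exact: sqr_ge0.
have mi : `|M T i| <= 2 * s.
  rewrite -(ler_pXn2r (_ : 0 < 2)%N) ?nnegrE ?mulr_ge0 // -normrX ger0_norm ?sqr_ge0 //.
  rewrite exprMn s2; apply: le_trans (_ : _ <= 4 * (K%:R * a)) _; last by lra.
  apply: le_trans mA; rewrite (bigD1 i) //= lerDl sumr_ge0 // => j _.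
  exact: sqr_ge0.
by apply: le_trans (ler_normB _ _) _; lra.
Qed.

Lemma one_step_bound :
  bernE theta (fun T => sup_dist (M T) l ^+ 2) <= step_const R * q%:R * a.
Proof.
have th01 : 0 <= theta <= 1 by have /andP[h1 ->] := theta_half; lra.
have SKR : #|S|%:R <= K%:R :> R by rewrite ler_nat.
pose g := Num.sqrt (512 * q%:R * a).
have g2 : g ^+ 2 = 512 * q%:R * a by rewrite sqr_sqrtr // !mulr_ge0 // ltW.
have g0 : 0 < g by rewrite sqrtr_gt0 !mulr_gt0 // ltr0n.
have small : 512 * q%:R * a <= g ^+ 2 by rewrite g2.
have Ndec := spectral_dec_opp Adec.
have l'_sorted := nonincreasing_opp l_sorted.
have rowN i : \sum_j (- A) i j ^+ 2 <= if i \in S then a else 0.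
  by under eq_bigr => j _ do rewrite mxE sqrrN; apply: rowA.
pose V' : 'M[R]_n := \matrix_(i, j) V (rev_ord i) j.
pose l' i := - l (rev_ord i).
pose G T := side_gauge V l theta g q T + side_gauge V' l' theta g q T.
have close T : G T < 1 -> sup_dist (M T) l <= 5 * g.
  move=> GT; have G1 : side_gauge V l theta g q T < 1.
    by apply: le_lt_trans GT; rewrite lerDl side_gauge_ge0.
  have G2 : side_gauge V' l' theta g q T < 1.
    by apply: le_lt_trans GT; rewrite lerDr side_gauge_ge0.
  have [U Bdec] := Mdec T; have mS := M_sorted T.
  have B'dec := spectral_dec_opp Bdec.
  have sN : - sampled theta A T = sampled theta (- A) T.
    by rewrite /sampled mulmxN mulNmx.
  rewrite sN in B'dec; have m'S := nonincreasing_opp mS.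
  apply: sup_dist_le => [|i]; first by rewrite mulr_ge0 // ltW.
  have up1 := side_upper Adec l_sorted theta_half q_gt0 g0 Bdec mS i G1.
  have lo1 := side_lower Adec l_sorted theta_half q_gt0 g0 Bdec mS (i := i) G1.
  have up2 := side_upper Ndec l'_sorted theta_half q_gt0 g0 B'dec m'S (rev_ord i) G2.
  have lo2 := side_lower Ndec l'_sorted theta_half q_gt0 g0 B'dec m'S (i := rev_ord i) G2.
  rewrite /= rev_ordK in up2 lo2.
  (* If l_i < 2 g, the upper bound applied to -A gives m_i >= min(l_i, 0) - 3 g >= l_i - 5 g;
     symmetrically on the other side. This is the origin of 5 g. *)
  rewrite ler_norml; apply/andP; split.
    have [h|h] := leP (2 * g) (l i); first by have := lo1 h; lra.
    by move: up2; rewrite maxEle; case: ifP; lra.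
  have [h|h] := leP (2 * g) (- l i); first by have := lo2 h; lra.
  by move: up1; rewrite maxEle; case: ifP; lra.
have G0 T : 0 <= G T by rewrite addr_ge0 ?side_gauge_ge0.
have Ka : 0 <= K%:R * a by rewrite mulr_ge0 // ltW.
(* Either the gauge is below 1 and the error is at most 5 g, or it is at least 1 and can multiply
   the crude bound. *)
have pw T : sup_dist (M T) l ^+ 2 <= 25 * g ^+ 2 + 9 * (K%:R * a) * G T.
  have c0 : 0 <= 9 * (K%:R * a) * G T by rewrite !mulr_ge0 // ltW.
  have [GT|/close D] := leP 1 (G T).
    have := sup_dist_crude T; have := sqr_ge0 g.
    set D := sup_dist _ _ ^+ 2; set y := K%:R * a in Ka *; nra.
  have D0 := sup_dist_ge0 (M T) l; nra.
apply: le_trans (bernE_le th01 pw) _.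
rewrite bernED bernE_cst bernEZ.
have EG : bernE theta G <= 4 * K%:R ^+ 2 * (1 / 32) ^+ q.
  rewrite bernED (_ : 4 * K%:R ^+ 2 * _ = 2 * K%:R ^+ 2 * (1 / 32) ^+ q +
     2 * K%:R ^+ 2 * (1 / 32) ^+ q :> R); last by ring.
  apply: lerD.
    exact: (bernE_side_gauge Adec l_sorted rowA SKR theta_half (ltW a_gt0)).
  exact: (bernE_side_gauge Ndec l'_sorted rowN SKR theta_half (ltW a_gt0)).
(* The exceptional term is 36 a K^3 / 32^q, and K <= 2^q gives K^3 <= K^5 <= 32^q. *)
have K3 : K%:R ^+ 3 * (1 / 32) ^+ q <= 1 :> R.
  rewrite div1r exprVn ler_pdivrMr ?exprn_gt0 // mul1r -!natrX ler_nat.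
  apply: (@leq_trans (K ^ 5)); first by rewrite leq_pexp2l.
  by rewrite (_ : 32 = 2 ^ 5)%N // -expnM mulnC expnM leq_exp2r.
have q1 : 1 <= q%:R :> R by rewrite ler1n.
apply: (@le_trans _ _ (25 * g ^+ 2 + 36 * a * (K%:R ^+ 3 * (1 / 32) ^+ q))).
  rewrite lerD2l; apply: le_trans (ler_wpM2l _ EG) _; first by rewrite mulr_ge0.
  by rewrite le_eqVlt; apply/orP; left; apply/eqP; ring.
have a0 := a_gt0; rewrite g2 /step_const; set k := _ * _ ^+ q in K3 *; nra.
Qed.

End TwoSides.
End OneStep.

(** * Spectra as lists and the output of Algorithm U *)

Section CharPoly.

(** Sylvester's identity: the determinant of the block matrix with rows (X, Y) and (Z, 1) is
    computed by eliminating either off-diagonal block. *)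
Lemma char_poly_mulmxC (R : idomainType) (k n : nat) (Y : 'M[R]_(k, n)) (Z : 'M[R]_(n, k)) :
  char_poly (Y *m Z) * 'X^n = char_poly (Z *m Y) * 'X^k.
Proof.
pose Yp := map_mx polyC Y; pose Zp := map_mx polyC Z.
pose Q : 'M[{poly R}]_(k + n) := block_mx 'X%:M Yp Zp 1%:M.
have Q1 : \det Q = char_poly (Y *m Z).
  transitivity (\det (Q *m block_mx 1%:M 0 (- Zp) 1%:M)).
    by rewrite det_mulmx det_lblock !det1 !mulr1.
  rewrite mulmx_block !(mulmx0, mulmx1, mulmxN, mul1mx, add0r) subrr.
  by rewrite det_ublock det1 mulr1 -map_mxM.
have Q2 : \det Q * 'X^n = char_poly (Z *m Y) * 'X^k.
  transitivity (\det (Q *m block_mx 1%:M (- Yp) 0 'X%:M)).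
    by rewrite det_mulmx det_ublock det1 mul1r det_scalar.
  rewrite mulmx_block !(mulmx0, mulmx1, mulmxN, mul1mx, addr0).
  rewrite mul_scalar_mx mul_mx_scalar addNr det_lblock det_scalar mulrC.
  by rewrite addrC -map_mxM.
by rewrite -Q1 Q2.
Qed.

Lemma char_poly_mulmxC_sq (R : idomainType) (n : nat) (Y Z : 'M[R]_n) :
  char_poly (Y *m Z) = char_poly (Z *m Y).
Proof.
by apply: (mulIf (monic_neq0 (monicXn R n))); apply: char_poly_mulmxC.
Qed.

Lemma char_poly_spectral_dec (R : rcfType) n (A V : 'M[R]_n) (l : 'I_n -> R) :
  spectral_dec A V l -> char_poly A = \prod_i ('X - (l i)%:P).
Proof.
move=> [VV ->]; rewrite -mulmxA char_poly_mulmxC_sq -mulmxA VV mulmx1.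
rewrite char_poly_trig ?diag_mx_is_trig //.
by apply: eq_bigr => i _; rewrite !mxE eqxx.
Qed.

End CharPoly.

Section Eigs.
Variable R : rcfType.

Lemma sorted_spectral_dec n (A : 'M[R]_n) : A^T = A ->
  exists (l : 'I_n -> R), nonincreasing l /\ exists V, spectral_dec A V l.
Proof.
move=> /symmetric_spectral[V [d [VV AE]]].
pose s := sort (fun x y : R => y <= x) (codom (fun i => d 0 i)).
have s_sorted : sorted (fun x y : R => y <= x) s.
  by apply: sort_sorted => x y; exact: le_total.
have [p sE] : exists p : 'S_n, s = [seq d 0 (p i) | i <- enum 'I_n].
  have : perm_eq s (mktuple (fun i => d 0 i)) by rewrite perm_sort codomE.
  case/tuple_permP => p ->; exists p => /=.
  by apply: eq_map => i /=; rewrite tnth_mktuple.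
exists (fun i => d 0 (p i)); split.
  move=> i j ij; have sz : size s = n by rewrite sE size_map size_enum_ord.
  have sn k : d 0 (p k) = nth 0 s k.
    by rewrite sE (nth_map k) ?size_enum_ord // nth_ord_enum.
  rewrite !sn; apply: (sorted_leq_nth _ _ _ s_sorted) => //; rewrite ?inE ?sz //.
  by move=> x y z yx xz; apply: le_trans yx.
exists (row_perm p V); split.
  rewrite row_permE trmx_mul -mulmxA (mulmxA V) VV mul1mx.
  by rewrite tr_perm_mx -perm_mxM mulgV perm_mx1.
rewrite AE; apply/matrixP => i j; rewrite !mxE (reindex_inj (@perm_inj _ p)).
by apply: eq_bigr => k _; rewrite !mul_mx_diag !mxE.
Qed.

Definition is_eigs n (A : 'M[R]_n) (l : 'I_n -> R) : Prop :=
  nonincreasing l /\ exists V, spectral_dec A V l.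

(** A total function obtained by choice; its value is arbitrary when A is not symmetric. *)
Definition eigs n (A : 'M[R]_n) : 'I_n -> R :=
  ClassicalEpsilon.epsilon (inhabits (fun=> 0)) (is_eigs A).

Lemma eigsP n (A : 'M[R]_n) : A^T = A -> is_eigs A (eigs A).
Proof.
by move=> /sorted_spectral_dec H; apply: ClassicalEpsilon.epsilon_spec.
Qed.

Lemma sampled_sym n (A : 'M[R]_n) theta T : A^T = A -> (sampled theta A T)^T = sampled theta A T.
Proof. by move=> As; rewrite /sampled !trmx_mul tr_diag_mx As mulmxA. Qed.

End Eigs.

Lemma geR_trans : transitive geR.
Proof. by move=> x y z yx xz; apply: le_trans yx. Qed.

Lemma is_spectrum_inj m (B : 'M[R]_m) l l' : is_spectrum B l -> is_spectrum B l' -> l = l'.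
Proof.
move=> [_ ls lB] [_ ls' lB'].
apply: (sorted_eq geR_trans _ ls ls'); last by apply: prod_XsubC_eq; rewrite -lB.
by move=> x y /le_anti.
Qed.

Lemma nth_codom_ord (T : Type) (x0 : T) n (f : 'I_n -> T) (i : 'I_n) :
  nth x0 (codom f) i = f i.
Proof. by rewrite codomE (nth_map i) ?size_enum_ord // nth_ord_enum. Qed.

Lemma is_spectrum_eigs n (A : 'M[R]_n) : A^T = A -> is_spectrum A (codom (eigs A)).
Proof.
move=> /eigsP[l_sorted [V Adec]]; split; first by rewrite size_codom card_ord.
  apply/(sortedP 0) => i; rewrite size_codom card_ord => i1.
  have i0 := ltnW i1; rewrite /geR.
  rewrite (nth_codom_ord 0 (eigs A) (Ordinal i0)) (nth_codom_ord 0 (eigs A) (Ordinal i1)).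
  exact: l_sorted.
rewrite (char_poly_spectral_dec Adec) codomE big_map.
by rewrite big_enum.
Qed.

Lemma sampling_matrix_gram n (p : R) (T : {set 'I_n}) : 0 < p ->
  (sampling_matrix p T)^T *m sampling_matrix p T =
  sampling_diag p T *m sampling_diag p T.
Proof.
(* The two square roots come from different libraries and are compared only through their
   squares. *)
move=> p0; have pp : R_sqrt.sqrt p * R_sqrt.sqrt p = p.
  by apply: R_sqrt.sqrt_sqrt; apply/RleP/ltW.
have qq : Num.sqrt p * Num.sqrt p = p by rewrite -expr2 sqr_sqrtr // ltW.
apply/matrixP => i j; rewrite mulmx_diag !mxE.
transitivity (\sum_(r < #|T|) ((i == enum_val r) && (j == enum_val r))%:R / p).
  apply: eq_bigr => r _; rewrite !mxE mulrACA -invfM pp.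
  by rewrite -natrM mulnb.
rewrite -mulr_suml; have [->|ij] := eqVneq i j; last first.
  rewrite mulr0n big1 ?mul0r // => r _.
  by case: eqP => // <-; rewrite eq_sym (negPf ij).
rewrite mulr1n; case: ifPn => jT; last first.
  rewrite mulr0 big1 ?mul0r // => r _; case: eqP => // jr.
  by move: (enum_valP r); rewrite -jr (negPf jT).
rewrite -invfM qq (bigD1 (enum_rank_in jT j)) //= enum_rankK_in // eqxx /= big1 => [|r rj].
  by rewrite addr0 mul1r.
rewrite andbb; case: eqP => // jr.
by case/eqP: rj; apply: enum_val_inj; rewrite enum_rankK_in.
Qed.

(** With S the sampling matrix, S (A S^T) and (A S^T) S have the same characteristic polynomial up
    to powers of X, which account for the added zeros. Since S^T S is the square of the diagonal
    rescaling, a further cyclic exchange gives [sampled]. *)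
Lemma is_spectrum_U_output n (A : 'M[R]_n) (p : R) (T : {set 'I_n}) mu : 0 < p ->
  is_spectrum (sampled_matrix A p T) mu ->
  is_spectrum (sampled p A T) (U_output n #|T| mu).
Proof.
move=> p0 [mu_size _ muE].
have Tn : (#|T| <= n)%N by rewrite -[X in (_ <= X)%N]card_ord max_card.
split.
- by rewrite size_sort size_cat size_nseq mu_size subnKC.
- by apply: sort_sorted => x y; apply: le_total.
rewrite (perm_big _ (permEl (perm_sort _ _))) big_cat /= -muE.
have -> : \prod_(x <- nseq (n - #|T|) 0) ('X - x%:P) = 'X^(n - #|T|) :> {poly R}.
  by rewrite big_nseq subr0 -Monoid.iteropE; elim: (n - #|T|)%N => //= k ->; rewrite exprS.
have := char_poly_mulmxC (sampling_matrix p T) (A *m (sampling_matrix p T)^T).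
rewrite -mulmxA sampling_matrix_gram // mulmxA -/(sampled_matrix A p T).
rewrite (mulmxA A) -[in RHS](char_poly_mulmxC_sq (sampling_diag p T)) => H.
apply: (mulIf (monic_neq0 (monicXn R #|T|))).
rewrite -[RHS]mulrA -exprD subnK // /sampled -mulmxA -H.
by [].
Qed.

Lemma U_output_eigs n (A : 'M[R]_n) (p : R) (T : {set 'I_n}) mu : A^T = A -> 0 < p ->
  is_spectrum (sampled_matrix A p T) mu ->
  U_output n #|T| mu = codom (eigs (sampled p A T)).
Proof.
move=> As p0 /(is_spectrum_U_output p0) H; apply: (is_spectrum_inj H).
exact/is_spectrum_eigs/sampled_sym.
Qed.

Lemma U_succeeds_on_sampled n (A : 'M[R]_n) (p alpha : R) (T : {set 'I_n}) :
  A^T = A -> 0 < p -> sup_dist (eigs (sampled p A T)) (eigs A) <= alpha ->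
  U_succeeds_on A (sampled_matrix A p T) alpha.
Proof.
move=> As p0 close lam mu lamA muM; rewrite (U_output_eigs As p0 muM).
rewrite (is_spectrum_inj lamA (is_spectrum_eigs As)); split.
  by rewrite !size_codom.
rewrite size_codom card_ord => i i_n.
rewrite !(nth_codom_ord 0 _ (Ordinal i_n)).
exact: le_trans (sup_dist_ge _ _ _) close.
Qed.

Lemma U_succeeds_on_full n (A : 'M[R]_n) (alpha : R) : 0 <= alpha ->
  U_succeeds_on A A alpha.
Proof.
move=> alpha0 lam mu lamA muA; rewrite (is_spectrum_inj muA lamA).
have [lam_size lam_sorted _] := lamA.
rewrite /U_output subnn cats0 (sorted_sort geR_trans lam_sorted).
by split=> // i _; rewrite subrr normr0.
Qed.

(** * Recursion on the sampling rate *)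

Section Recursion.
Variables (F : rcfType) (n : nat) (A : 'M[F]_n).
Hypothesis A_sym : A^T = A.
Hypothesis A_bound : forall i j, `|A i j| <= 1.

Lemma sup_distxx (u : 'I_n -> F) : sup_dist u u = 0.
Proof.
apply/le_anti; rewrite sup_dist_ge0 andbT.
by apply: sup_dist_le => // i; rewrite subrr normr0.
Qed.

Lemma sampled_setI (p theta : F) (T S : {set 'I_n}) : 0 <= p -> 0 <= theta ->
  sampled (p * theta) A (T :&: S) = sampled theta (sampled p A T) S.
Proof.
move=> p0 th0; apply/matrixP => i j; rewrite !sampledE ?mulr_ge0 // !inE.
case: (i \in T); case: (j \in T); case: (i \in S); case: (j \in S) => //=;
  by rewrite ?mul0r // invfM mulrA.
Qed.

Lemma sampled_full : sampled 1 A setT = A.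
Proof. by apply/matrixP => i j; rewrite sampledE // !inE divr1. Qed.

Lemma step_const_gt0 : 0 < step_const F.
Proof. by rewrite /step_const; lra. Qed.

Definition sq_error (p : F) : F :=
  bernE p (fun T => sup_dist (eigs (sampled p A T)) (eigs A) ^+ 2).

(** The sampled matrix is supported on [T] with entries at most 1 / p, so its rows have squared norm
    at most |T| / p^2. Using |T| + 1 keeps the parameters positive when [T] is empty. *)
Lemma resample_bound (p theta : F) (T : {set 'I_n}) (q : nat) :
  0 < p -> 1 / 2 <= theta <= 1 -> (0 < q)%N -> (#|T|.+1 <= 2 ^ q)%N ->
  bernE theta (fun S =>
     sup_dist (eigs (sampled (p * theta) A (T :&: S))) (eigs (sampled p A T)) ^+ 2) <=
  step_const F * q%:R * (#|T|.+1%:R / p ^+ 2).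
Proof.
move=> p0 th q0 Kq; have th0 : 0 <= theta by case/andP: th; lra.
under eq_bernE => S do rewrite sampled_setI ?(ltW p0) //.
have A'sym := sampled_sym p T A_sym.
have [l_sorted [V Adec]] := eigsP A'sym.
apply: (one_step_bound (S := T) (K := #|T|.+1) Adec l_sorted
  (M := fun S => eigs (sampled theta (sampled p A T) S))) => //.
- move=> i; case: ifPn => iT; last first.
    by rewrite big1 // => j _; rewrite sampledE ?(ltW p0) // (negPf iT) expr0n.
  apply: (@le_trans _ _ (\sum_(j in T) (p ^+ 2)^-1)).
    rewrite [leRHS]big_mkcond; apply: ler_sum => j _; rewrite sampledE ?(ltW p0) // iT /=.
    case: ifP => _; last by rewrite expr0n.
    rewrite expr_div_n -[leRHS]mul1r ler_wpM2r ?invr_ge0 ?sqr_ge0 //.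
    by rewrite -[A i j ^+ 2]ger0_norm ?sqr_ge0 // normrX expr_le1.
  rewrite sumr_const -[leLHS]mulr_natl ler_wpM2r ?invr_ge0 ?sqr_ge0 //.
  by rewrite ler_nat.
- by rewrite divr_gt0 ?exprn_gt0 // ltr0n.
- by move=> S; have [_] := eigsP (sampled_sym theta S A'sym).
- by move=> S; have [] := eigsP (sampled_sym theta S A'sym).
Qed.

(** Averages the previous bound over [T], whose size is random and may exceed 2^Q. *)
Lemma level_bound (p theta : F) (Q : nat) :
  0 < p <= 1 -> 1 / 2 <= theta <= 1 -> 1 <= p * n%:R -> (0 < Q)%N ->
  p * n%:R + 1 <= 2 ^+ Q ->
  bernE p (fun T => bernE theta (fun S =>
     sup_dist (eigs (sampled (p * theta) A (T :&: S))) (eigs (sampled p A T)) ^+ 2)) <=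
  5 * step_const F * Q%:R * n%:R / p.
Proof.
move=> /andP[p0 p1] th m1 Q0 mQ; have p01 : 0 <= p <= 1 by rewrite ltW.
(* The order follows [T]: with k the quotient, |T| + 1 < (k + 1) 2^Q <= 2^(Q + k). The correction is
   linear in |T|, so the second moment of |T| suffices. *)
pose q (T : {set 'I_n}) := (Q + #|T|.+1 %/ 2 ^ Q)%N.
have Kq (T : {set 'I_n}) : (#|T|.+1 <= 2 ^ q T)%N.
  apply: ltnW; apply: (@leq_trans ((#|T|.+1 %/ 2 ^ Q).+1 * 2 ^ Q)).
    by rewrite ltn_ceil // expn_gt0.
  by rewrite /q expnD mulnC leq_mul2l ltn_expl ?orbT.
have Q2 : 0 < 2 ^+ Q :> F by rewrite exprn_gt0.
have qR (T : {set 'I_n}) : (q T)%:R <= Q%:R + #|T|.+1%:R / 2 ^+ Q :> F.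
  rewrite /q natrD lerD2l ler_pdivlMr // -natrX -natrM ler_nat.
  exact: leq_trunc_div.
pose m : F := p * n%:R.
apply: (@le_trans _ _ (bernE p (fun T => step_const F / p ^+ 2 *
    (Q%:R * (#|T|%:R + 1) + (2 ^+ Q)^-1 * (#|T|%:R ^+ 2 + (2 * #|T|%:R + 1)))))).
  apply: bernE_le => // T.
  apply: le_trans (resample_bound p0 th _ (Kq T)) _; first by rewrite addn_gt0 Q0.
  have -> : step_const F * (q T)%:R * (#|T|.+1%:R / p ^+ 2) =
     step_const F / p ^+ 2 * ((q T)%:R * #|T|.+1%:R) by ring.
  apply: ler_wpM2l; first by rewrite divr_ge0 ?sqr_ge0 // ltW // step_const_gt0.
  apply: le_trans (ler_wpM2r _ (qR T)) _ => //.
  by rewrite -natr1 le_eqVlt; apply/orP; left; apply/eqP; ring.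
rewrite bernEZ bernED !bernEZ !bernED bernEZ !bernE_cst !bernE_card card_ord -/m.
have Ecard := @bernE_card_sqr F 'I_n p p01; rewrite card_ord -/m in Ecard.
have -> : 5 * step_const F * Q%:R * n%:R / p = step_const F / p ^+ 2 * (5 * Q%:R * m).
  by rewrite /m; field; rewrite gt_eqF.
apply: ler_wpM2l; first by rewrite divr_ge0 ?sqr_ge0 // ltW // step_const_gt0.
have Q1 : 1 <= Q%:R :> F by rewrite ler1n.
have mQ' : (2 ^+ Q)^-1 * (m + 1) <= 1 by rewrite ler_pdivrMl // mulr1.
set v := (2 ^+ Q)^-1 in mQ' *; have v0 : 0 <= v by rewrite invr_ge0 ltW.
rewrite -/m in m1; set E2 := bernE _ _ in Ecard *.
have h1 : v * (E2 + (2 * m + 1)) <= v * (m + 1) * (m + 1) + v * (m + 1).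
  rewrite -mulrA -mulrDr ler_wpM2l //; nra.
have h2 : v * (m + 1) * (m + 1) <= m + 1 by rewrite -[leRHS]mul1r ler_wpM2r //; lra.
have h3 : Q%:R * 1 <= Q%:R * m by rewrite ler_wpM2l.
nra.
Qed.

Lemma sq_error_recursion (p theta : F) :
  0 < p <= 1 -> 1 / 2 <= theta <= 1 ->
  sq_error (p * theta) <= 7 / 6 * sq_error p + 7 *
    bernE p (fun T => bernE theta (fun S =>
     sup_dist (eigs (sampled (p * theta) A (T :&: S))) (eigs (sampled p A T)) ^+ 2)).
Proof.
move=> /andP[p0 p1] /andP[th0 th1].
rewrite /sq_error -bernE_setI -!bernEZ -bernED.
apply: bernE_le => [|T]; first by rewrite ltW.
rewrite -bernEZ -[7 / 6 * _](bernE_cst 'I_n theta) -bernED.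
apply: bernE_le => [|S]; first by rewrite th1 andbT; lra.
set B := eigs (sampled _ A (T :&: S)); set B' := eigs (sampled p A T).
have := sup_dist_triangle B B' (eigs A).
have := sup_dist_ge0 B B'; have := sup_dist_ge0 B' (eigs A); have := sup_dist_ge0 B (eigs A).
set x := sup_dist B B'; set y := sup_dist B' _; set z := sup_dist B _ => z0 y0 x0 zxy.
have : z ^+ 2 <= (x + y) ^+ 2 by rewrite lerXn2r ?nnegrE // addr_ge0.
(* 7 x^2 + 7/6 y^2 - (x + y)^2 = (6 x - y)^2 / 6. The coefficient of y^2 must be below 2, since
   halving the rate doubles the target bound. *)
have := sqr_ge0 (6 * x - y); nra.
Qed.

Lemma sq_error_full : sq_error 1 = 0.
Proof. by rewrite /sq_error bernE_full sampled_full sup_distxx expr0n. Qed.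

(** Induction on [J], which bounds the number of halvings and is absent from the conclusion. For p
    <= 1/2 the sample is half of one at rate 2 p; otherwise it is reached from the full matrix in
    one step. Doubling the rate raises [Q] by one. *)
Lemma sq_error_bound (p : F) (J Q : nat) :
  0 < p <= 1 -> 1 <= p * 2 ^+ J -> 1 <= p * n%:R -> (1 < Q)%N -> p * n%:R + 1 <= 2 ^+ Q ->
  sq_error p <= 210 * step_const F * Q%:R * n%:R / p.
Proof.
have c0 := step_const_gt0; elim: J p Q => [|J IHJ] p Q /andP[p0 p1] pJ m1 Q1 mQ.
  have -> : p = 1 by apply/le_anti; rewrite p1 -[p]mulr1.
  by rewrite sq_error_full divr_ge0 ?mulr_ge0 // ltW.
have QR : 2 <= Q%:R :> F by rewrite ler_nat.
have n0 : 0 <= n%:R :> F by [].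
have QS : Q.+1%:R = Q%:R + 1 :> F by rewrite -natr1.
have y0 : 0 <= n%:R / p by rewrite divr_ge0 // ltW.
have [p2|p2] := leP (2 * p) 1.
  have th : 1 / 2 <= (1 / 2 : F) <= 1 by apply/andP; split; lra.
  have p2' : 0 < 2 * p <= 1 by apply/andP; split; lra.
  have m2 : 1 <= 2 * p * n%:R by lra.
  have mQ2 : 2 * p * n%:R + 1 <= 2 ^+ Q.+1 by rewrite exprS; lra.
  have rec := sq_error_recursion p2' th.
  have lev := level_bound p2' th m2 (ltn0Sn Q) mQ2.
  have pJ2 : 1 <= 2 * p * 2 ^+ J by move: pJ; rewrite exprS; lra.
  have ih := IHJ (2 * p) Q.+1 p2' pJ2 m2 (ltnW Q1 : (1 < Q.+1)%N) mQ2.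
  rewrite (_ : 2 * p * (1 / 2) = p) in rec lev; last by field.
  move: lev ih; rewrite QS => lev ih.
  apply: le_trans rec _.
  have c76 : 0 <= 7 / 6 :> F by lra.
  apply: le_trans (lerD (ler_wpM2l c76 ih) (ler_wpM2l (ler0n _ 7) lev)) _.
  have e1 c : c * (Q%:R + 1) * n%:R / (2 * p) = c / 2 * (Q%:R + 1) * (n%:R / p).
    by field; rewrite gt_eqF.
  rewrite !e1 -[leRHS]mulrA; set y := n%:R / p in y0 *.
  (* The sum is (7/12 * 210 + 35/2) (Q + 1) = 140 (Q + 1) times [step_const F * y], and 140 (Q + 1)
     <= 210 Q exactly when Q >= 2. *)
  have : 2 * (step_const F * y) <= Q%:R * (step_const F * y).
    by rewrite ler_wpM2r // mulr_ge0 // ltW.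
  lra.
have th : 1 / 2 <= p <= 1 by apply/andP; split; lra.
have p1' : 0 < (1 : F) <= 1 by rewrite ltr01 lexx.
have m2 : 1 <= 1 * n%:R :> F.
  by rewrite mul1r; apply: le_trans m1 _; rewrite -[leRHS]mul1r ler_wpM2r.
have mQ2 : 1 * n%:R + 1 <= 2 ^+ Q.+1 :> F.
  rewrite exprS mul1r; have : n%:R <= 2 * p * n%:R by rewrite -[leLHS]mul1r ler_wpM2r // ltW.
  lra.
have rec := sq_error_recursion p1' th.
have lev := level_bound p1' th m2 (ltn0Sn Q) mQ2.
rewrite mul1r sq_error_full mulr0 add0r in rec.
rewrite mul1r divr1 QS in lev.
apply: le_trans rec _; apply: le_trans (ler_wpM2l _ lev) _ => //.
have ny : n%:R <= n%:R / p by rewrite ler_pdivlMr // -[leRHS]mulr1 ler_wpM2l.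
rewrite -[leRHS]mulrA; set y := n%:R / p in y0 ny *.
have s1 : 0 <= step_const F * (Q%:R + 1).
  by apply: mulr_ge0; [exact: ltW | exact: addr_ge0].
have := ler_wpM2l s1 ny.
have : 2 * (step_const F * y) <= Q%:R * (step_const F * y).
  by rewrite ler_wpM2r // mulr_ge0 // ltW.
have := mulr_ge0 (ltW c0) y0; lra.
Qed.

End Recursion.

(** * The sample size *)

(** Logarithms enter the argument only through this bound, which rests on e <= 3. *)
Lemma ln_le_nat (x : R) (r : nat) : 0 < x -> Rpower.ln x <= r%:R -> x <= 3 ^+ r.
Proof.
move=> x0 xr; rewrite -[x]Rpower.exp_ln; last exact/RltP.
apply: (@le_trans _ _ (Rtrigo_def.exp r%:R)).
  have [->//|ne] := eqVneq (Rpower.ln x) r%:R.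
  apply/ltW/RltP/Rpower.exp_increasing/RltP.
  by rewrite lt_neqAle ne.
rewrite -expRX lerXn2r ?nnegrE //.
  exact/RleP/RIneq.Rlt_le/Exp_prop.exp_pos.
have := Rpower.exp_le_3 => /RleP; rewrite RealsE.
by [].
Qed.

Lemma nat_le_exp2 (m : nat) : m.+1%:R <= 2 ^+ m :> R.
Proof. by rewrite -natrX ler_nat ltn_expl. Qed.

(** Put w = eps^2 delta and s = d / w. The order [Q] must exceed log2(s + 1) yet cost at most d / C:
    the part from 1 / w is paid by the logarithm L in the hypothesis, the part from d by d
    itself. *)
Lemma sample_size_bound (C : R) : 0 < C -> exists2 c : R, 0 < c &
  forall eps delta s : R, 0 < eps < 1 / 2 -> 0 < delta < 1 / 2 ->
    c / (eps ^+ 2 * delta) * Rpower.ln (1 / (eps * delta)) <= s ->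
    1 <= s /\ exists Q : nat,
      [/\ (1 < Q)%N, s + 1 <= 2 ^+ Q & C * Q%:R <= s * (eps ^+ 2 * delta)].
Proof.
have ceil_nat (x : R) : 0 <= x -> exists m : nat, x <= m.+1%:R <= x + 1.
  move=> x0; exists (Num.truncn x); rewrite (ltW (truncnS_gt x)) /=.
  by rewrite -natr1 lerD2r; case/andP: (truncn_itv x0).
move=> C0; have [h hC] : exists h : nat, 4 * C <= 2 ^+ h.
  have [m /andP[Cm _]] := ceil_nat (4 * C) (mulr_ge0 (ler0n _ 4) (ltW C0)).
  exists m; exact: le_trans Cm (nat_le_exp2 m).
have h0 : 0 <= h%:R :> R by [].
exists (2 * C * (9 + h%:R) + 1).
  by rewrite ltr_wpDl // !mulr_ge0 ?addr_ge0 // ltW.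
move=> eps delta s /andP[e0 e1] /andP[d0 d1].
set L := Rpower.ln _; set c := _ + 1.
have c1 : 1 <= c by rewrite lerDr !mulr_ge0 ?addr_ge0 // ltW.
have ed0 : 0 < eps * delta by rewrite mulr_gt0.
have L1 : 1 < L.
  rewrite ltNge; apply/negP => /(@ln_le_nat _ 1); rewrite divr_gt0 // => /(_ isT).
  by rewrite expr1 ler_pdivrMr //; nra.
pose w := eps ^+ 2 * delta.
have w0 : 0 < w by rewrite mulr_gt0 ?exprn_gt0.
have w1 : w <= 1 by rewrite /w expr2; nra.
rewrite -/w mulrAC ler_pdivrMr // => cL.
pose d := s * w.
have dcL : c * L <= d by [].
have dge1 : 1 <= d by apply: le_trans dcL; nra.
have sd : s = d / w by rewrite /d mulfK ?gt_eqF.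
have s1 : 1 <= s by rewrite sd ler_pdivlMr // mul1r; apply: le_trans dge1.
split=> //.
have [r /andP[Lr rL]] := ceil_nat L (ltW (lt_trans ltr01 L1)).
have de0 : 0 <= d / (4 * C) by rewrite divr_ge0 ?mulr_ge0 ?ltW //; lra.
have [e /andP[de ed]] := ceil_nat _ de0.
move: Lr rL de ed; set r' := r.+1; set e' := e.+1 => Lr rL.
rewrite ler_pdivrMr ?mulr_gt0 // mulrC => de /(ler_wpM2l (ltW C0)).
rewrite mulrDr mulr1 (_ : C * (d / (4 * C)) = d / 4); last by field; rewrite gt_eqF.
move=> ed.
(* Here 2^(4 r') >= 1 / w because 3^2 <= 2^4, and 2^(h + e') >= d + 1. The cost is at most C (4 L +
   5 + h) + d / 4 <= C (9 + h) L + d / 4, hence the 9 + h in the constant; the first term is at most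
   d / 2. *)
exists (4 * r' + (h + e'))%N; split.
- by rewrite /r' mulnS -addnA ltn_addr.
- have xr : w^-1 <= 2 ^+ (4 * r').
    have x3 : (eps * delta)^-1 <= 3 ^+ r'.
      by rewrite -div1r; apply: ln_le_nat => //; rewrite divr_gt0.
    apply: (@le_trans _ _ (((eps * delta)^-1) ^+ 2)).
      rewrite exprVn lef_pV2 ?posrE ?exprn_gt0 //.
      by rewrite exprMn /w ler_wpM2l ?sqr_ge0 // expr2; nra.
    apply: (@le_trans _ _ ((3 ^+ r') ^+ 2)).
      by rewrite lerXn2r ?nnegrE ?invr_ge0 ?exprn_ge0 // ltW.
    rewrite -exprM mulnC !exprM lerXn2r ?nnegrE ?exprn_ge0 //; lra.
  have y0 : 0 < 2 ^+ (4 * r') :> R by rewrite exprn_gt0.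
  have y1 : 1 <= 2 ^+ (4 * r') :> R by rewrite exprn_ege1 //; lra.
  rewrite exprD; set y := 2 ^+ (4 * r') in xr y0 y1 *.
  have z1 : d + 1 <= 2 ^+ (h + e').
    apply: (@le_trans _ _ (2 ^+ h * e'.+1%:R)); last first.
      by rewrite exprD ler_wpM2l ?exprn_ge0 ?nat_le_exp2.
    have h1 : 1 <= 2 ^+ h :> R by rewrite exprn_ege1 //; lra.
    rewrite -[X in _ * X]natr1 mulrDr mulr1; apply: lerD => //.
    by apply: le_trans de _; rewrite ler_wpM2r.
  apply: (@le_trans _ _ (y * (d + 1))); last by rewrite ler_wpM2l // ltW.
  rewrite mulrDr mulr1 lerD // sd mulrC ler_wpM2r //; lra.
- rewrite -/w -/d !natrD natrM !mulrDr.
  have cL' : 2 * (C * (9 + h%:R) * L) <= d by apply: le_trans dcL; rewrite /c; nra.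
  have hL : C * h%:R <= C * h%:R * L.
    by rewrite -[leLHS]mulr1 ler_wpM2l ?mulr_ge0 // ltW.
  have CL : C <= C * L by rewrite -[leLHS]mulr1 ler_wpM2l // ltW.
  have Cr : C * r'%:R <= C * (L + 1) by rewrite ler_wpM2l // ltW.
  lra.
Qed.

(** * Success probability by Chebyshev's inequality *)

Theorem mainTheorem1 :
  exists c c0 : R, 0 < c /\ 0 < c0 /\
  forall (n : nat) (eps delta s : R) (A : 'M[R]_n),
    (1 <= n)%N ->
    0 < eps < c0 -> 0 < delta < c0 ->
    A^T = A ->
    (forall i j, `|A i j| <= 1) ->
    0 < s ->
    c / (eps ^+ 2 * delta) * Rpower.ln (1 / (eps * delta)) <= s ->
    1 - delta <= U_success_prob A s (eps * n%:R).
Proof.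
have C0 : 0 < 210 * step_const R by rewrite mulr_gt0 ?step_const_gt0.
have [c c_gt0 size] := sample_size_bound C0.
exists c, (1 / 2); split=> //; split; first by lra.
move=> n eps delta s A n_gt0 eps_itv delta_itv A_sym A_bound s_gt0.
move=> /(size _ _ _ eps_itv delta_itv)[s1 [Q [Q1 sQ CQ]]].
have /andP[e0 _] := eps_itv; have /andP[d0 _] := delta_itv.
have nR : 0 < n%:R :> R by rewrite ltr0n.
have a0 : 0 < eps * n%:R by rewrite mulr_gt0.
have indicatorT (P : Prop) : P -> indicator P = 1.
  by move=> HP; rewrite /indicator; case: ClassicalEpsilon.excluded_middle_informative.
rewrite /U_success_prob; case: ifPn => [_|]; last rewrite -ltNge => s_n.
  by rewrite indicatorT; [lra | exact/U_succeeds_on_full/ltW].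
cbv zeta; set p := s / n%:R.
have p0 : 0 < p by rewrite divr_gt0.
have p1 : p <= 1 by rewrite ler_pdivrMr // mul1r ltW.
have p01 : 0 <= p <= 1 by rewrite p1 ltW.
have pn : p * n%:R = s by rewrite divfK ?gt_eqF.
(* Any number of halvings reaching rate 1 will do, so the crude 2^m >= m + 1 is enough. *)
have pJ : 1 <= p * 2 ^+ (Num.truncn p^-1).+1.
  rewrite mulrC -ler_pdivrMr // div1r; apply: le_trans (nat_le_exp2 _).
  by apply/ltW/(lt_trans (truncnS_gt _)); rewrite ltr_nat.
have err : sq_error A p <= 210 * step_const R * Q%:R * n%:R / p.
  by apply: (sq_error_bound A_sym A_bound _ pJ) => //; rewrite ?p0 ?pn.
(* Since p n = s, this is precisely the inequality [CQ] multiplied by n. *)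
have err' : sq_error A p / (eps * n%:R) ^+ 2 <= delta.
  rewrite ler_pdivrMr ?exprn_gt0 //; apply: le_trans err _.
  rewrite ler_pdivrMr // (_ : delta * _ * p = s * (eps ^+ 2 * delta) * n%:R).
    by rewrite ler_wpM2r.
  by rewrite -pn; ring.
(* Chebyshev in pointwise form: 1 - D^2 / (eps n)^2 never exceeds the indicator of success. *)
apply: (@le_trans _ _ (bernE p (fun T =>
    1 + (- ((eps * n%:R) ^+ 2)^-1) * sup_dist (eigs (sampled p A T)) (eigs A) ^+ 2))).
  by rewrite bernED bernE_cst bernEZ -/(sq_error A p) mulNr lerD2l lerN2 mulrC.
rewrite (_ : \sum_T _ = bernE p (fun T =>
    indicator (U_succeeds_on A (sampled_matrix A p T) (eps * n%:R)))); last first.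
  by apply: eq_bigr => T _; rewrite bern_weightE card_ord.
apply: bernE_le => // T.
set D := sup_dist _ _.
have [close|far] := leP D (eps * n%:R).
  rewrite indicatorT; last exact: U_succeeds_on_sampled.
  by rewrite mulNr gerBl mulr_ge0 ?invr_ge0 ?sqr_ge0.
apply: (@le_trans _ _ 0).
  rewrite mulNr subr_le0 mulrC ler_pdivlMr ?exprn_gt0 // mul1r.
  by rewrite lerXn2r ?nnegrE // ltW // (lt_trans a0).
by rewrite /indicator; case: ClassicalEpsilon.excluded_middle_informative.
Qed.
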